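(* Let $H$ be a complex Hilbert space and let $\lambda\in[0,1]$. For every $T\in\mathcal{B}(H)$ and every integer $n\ge 0$, $$r(T)=\inf\{\|\Delta_\lambda^n(XTX^{-1})\| : X\in\mathcal{B}(H)\text{ invertible}\}=\inf\{\|\Delta_\lambda^n(e^{A}Te^{-A})\| : A\in\mathcal{B}(H)\text{ self-adjoint}\}.$$
   Context: $H$ is a (nonzero) complex Hilbert space, $\mathcal{B}(H)$ is the space of bounded linear operators on $H$ with the operator norm $\|\cdot\|$, and $r(T)$ is the spectral radius of $T$. For $T\in\mathcal{B}(H)$, $|T|=(T^*T)^{1/2}$ and $T=U|T|$ is the unique polar decomposition, with $U$ the partial isometry satisfying $\ker U=\ker T$. For $\lambda\in[0,1]$ the $\lambda$-Aluthge transform is $\Delta_\lambda(T)=|T|^{\lambda}U|T|^{1-\lambda}$, with the convention $|T|^0=I$, so that $\Delta_0(T)=U|T|=T$ and $\Delta_1(T)=|T|U$. Its iterates are $\Delta_\lambda^0(T)=T$ and $\Delta_\lambda^{n+1}(T)=\Delta_\lambda(\Delta_\lambda^n(T))$. *)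

(* Defs.v *)
From HB Require Import structures.
From mathcomp Require Import all_boot all_order all_algebra.
From mathcomp Require Import sesquilinear complex.
From mathcomp Require Import all_classical all_reals all_analysis.

Set Implicit Arguments.
Unset Strict Implicit.
Unset Printing Implicit Defensive.

Import Order.TTheory GRing.Theory Num.Theory.
Import numFieldNormedType.Exports.

Local Open Scope classical_set_scope.
Local Open Scope ring_scope.
Local Open Scope complex_scope.

HB.mixin Record NormedModule_isHilbert (R : realType) (H : Type)
    of CompleteNormedModule R[i] H := {
  inner : {dot H for Num.conj};
  inner_norm : forall x : H, inner x x = `|x| ^+ 2 }.

#[short(type="hilbertType")]
HB.structure Definition Hilbert (R : realType) :=
  {H of CompleteNormedModule R[i] H & NormedModule_isHilbert R H}.

Arguments inner {R s}.

Definition bounded_op_pred (R : realType) (H : normedModType R[i]) :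
  {pred H -> H} := fun f => `[< linear f /\ continuous f >].

Record bounded_op (R : realType) (H : normedModType R[i]) := BoundedOp {
  bounded_op_fun :> H -> H;
  _ : bounded_op_fun \in @bounded_op_pred R H }.

Section bounded_op_algebra.
Variables (R : realType) (H : normedModType R[i]).
Local Notation C := R[i].
Local Notation B := (bounded_op H).

Lemma bounded_op_linear (T : B) : linear T.
Proof. by case: T => f Tf; have /asboolP[] := Tf. Qed.

Lemma bounded_op_continuous (T : B) : continuous T.
Proof. by case: T => f Tf; have /asboolP[] := Tf. Qed.

HB.instance Definition _ (T : B) :=
  GRing.isLinear.Build C H H *:%R (T : H -> H) (bounded_op_linear T).

HB.instance Definition _ := [isSub for @bounded_op_fun R H].
HB.instance Definition _ := [Choice of bounded_op H by <:].

Lemma bounded_op_submod : submod_closed (@bounded_op_pred R H).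
Proof.
split.
  apply/asboolP; split; last exact: cst_continuous.
  by move=> a x y /=; rewrite scaler0 addr0.
move=> a f g /asboolP[lf cf] /asboolP[lg cg]; apply/asboolP; split.
  move=> b x y.
  rewrite [LHS]/(a *: f (b *: x + y) + g (b *: x + y)).
  rewrite [RHS]/(b *: (a *: f x + g x) + (a *: f y + g y)).
  rewrite lf lg !scalerDr !scalerA [b * a]mulrC. rewrite -[LHS]addrA -[RHS]addrA; congr (_ + _).
  by rewrite addrCA.
move=> x; apply: cvgD; last exact: cg.
by apply: cvgZr; exact: cf.
Qed.

HB.instance Definition _ :=
  GRing.isSubmodClosed.Build C (H -> H) (@bounded_op_pred R H) bounded_op_submod.
HB.instance Definition _ := [SubChoice_isSubLmodule of bounded_op H by <:].

Lemma bounded_op_ext (S T : B) : (forall x, S x = T x) -> S = T.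
Proof. by move=> ST; apply/val_inj/funext. Qed.

Lemma bounded_op_id_subproof : (fun x : H => x) \in @bounded_op_pred R H.
Proof. by apply/asboolP; split => // x. Qed.

Definition bounded_op_id : B := BoundedOp bounded_op_id_subproof.

Lemma bounded_op_comp_subproof (S T : B) :
  (fun x => S (T x)) \in @bounded_op_pred R H.
Proof.
apply/asboolP; split; first by move=> a x y /=; rewrite !linearP.
by move=> x; apply: continuous_comp; exact: bounded_op_continuous.
Qed.

Definition bounded_op_comp (S T : B) : B :=
  BoundedOp (bounded_op_comp_subproof S T).

Lemma bounded_op_compA : associative bounded_op_comp.
Proof. by move=> S T V; apply: bounded_op_ext. Qed.

Lemma bounded_op_comp1l : left_id bounded_op_id bounded_op_comp.
Proof. by move=> S; apply: bounded_op_ext. Qed.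

Lemma bounded_op_comp1r : right_id bounded_op_id bounded_op_comp.
Proof. by move=> S; apply: bounded_op_ext. Qed.

Lemma bounded_op_compDl : left_distributive bounded_op_comp +%R.
Proof. by move=> S T V; apply: bounded_op_ext. Qed.

Lemma bounded_op_compDr : right_distributive bounded_op_comp +%R.
Proof. by move=> S T V; apply: bounded_op_ext => x /=; rewrite linearD. Qed.

(* The ring need not be nontrivial: H may be the zero space. *)
HB.instance Definition _ := GRing.Zmodule_isPzRing.Build (bounded_op H)
  bounded_op_compA bounded_op_comp1l bounded_op_comp1r
  bounded_op_compDl bounded_op_compDr.

(* The norms of C and H take values in C = R[i]; they are real, so their real
   part is the usual norm. *)
Definition opnorm (T : B) : R :=
  sup [set complex.Re `|T x| | x in [set x : H | `|x| <= 1]].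

Lemma normC_Re (V : normedZmodType C) (x : V) : (complex.Re `|x|)%:C = `|x|.
Proof. by apply: RRe_real; exact: normr_real. Qed.

Lemma opnorm_has_sup (T : B) :
  has_sup [set complex.Re `|T x| | x in [set x : H | `|x| <= 1]].
Proof.
split; first by exists (complex.Re `|T 0|); exists 0 => //=; rewrite normr0.
have := continuous_linear_bounded 0 (@bounded_op_continuous T 0).
move=> /linear_boundedP/pinfty_ex_gt0[M M0 TM].
exists (complex.Re M) => _ [x /= x1 <-].
rewrite -lecR normC_Re RRe_real ?gtr0_real//.
by rewrite (le_trans (TM x))// ler_piMr// ltW.
Qed.

Lemma opnorm_ball (T : B) (x : H) : `|x| <= 1 -> `|T x| <= (opnorm T)%:C.
Proof.
move=> x1; rewrite -normC_Re lecR.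
by apply: sup_upper_bound; [exact: opnorm_has_sup|exists x].
Qed.

Lemma opnorm_le (T : B) (M : R) :
  (forall x, `|x| <= 1 -> `|T x| <= M%:C) -> opnorm T <= M.
Proof.
move=> TM; apply: ge_sup; first exact: (opnorm_has_sup T).1.
by move=> _ [x /= x1 <-]; rewrite -lecR normC_Re TM.
Qed.

Lemma opnormP (T : B) (x : H) : `|T x| <= (opnorm T)%:C * `|x|.
Proof.
have [->|x0] := eqVneq x 0; first by rewrite linear0 !normr0 mulr0.
have nx : 0 < `|x| by rewrite normr_gt0.
rewrite -ler_pdivrMr// mulrC -[`|x|^-1]ger0_norm ?invr_ge0//.
rewrite -normrZ -linearZ; apply: opnorm_ball.
by rewrite normrZ ger0_norm ?invr_ge0// mulVf ?gt_eqF.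
Qed.

Lemma opnorm_ge0 (T : B) : 0 <= opnorm T.
Proof.
rewrite -lecR; apply: (le_trans _ (@opnorm_ball T 0 _)) => //.
by rewrite normr0.
Qed.

Lemma opnormD (S T : B) :
  (opnorm (S + T))%:C <= (opnorm S)%:C + (opnorm T)%:C.
Proof.
rewrite -rmorphD lecR; apply: opnorm_le => x x1.
rewrite [X in `|X|](_ : _ = S x + T x)// rmorphD.
by rewrite (le_trans (ler_normD _ _))// lerD// opnorm_ball.
Qed.

Lemma opnormZ_le (a : C) (T : B) :
  (opnorm (a *: T))%:C <= `|a| * (opnorm T)%:C.
Proof.
rewrite -[`|a|]normC_Re -rmorphM lecR; apply: opnorm_le => x x1.
rewrite [X in `|X|](_ : _ = a *: T x)// rmorphM normrZ.
rewrite [X in _ <= X * _]normC_Re.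
by rewrite ler_wpM2l// opnorm_ball.
Qed.

Lemma opnormZ (a : C) (T : B) : (opnorm (a *: T))%:C = `|a| * (opnorm T)%:C.
Proof.
apply/eqP; rewrite eq_le opnormZ_le /=.
have [->|a0] := eqVneq a 0.
  by rewrite normr0 mul0r lecR opnorm_ge0.
rewrite -ler_pdivlMl ?normr_gt0// -normfV.
by rewrite -{1}[T](scalerK a0) opnormZ_le.
Qed.

Lemma opnorm_eq0 (T : B) : (opnorm T)%:C = 0 -> T = 0.
Proof.
move=> T0; apply: bounded_op_ext => x; apply/eqP; rewrite -normr_le0.
by rewrite (le_trans (opnormP T x))// T0 mul0r.
Qed.

HB.instance Definition _ := Lmodule_isNormed.Build C (bounded_op H)
  opnormD opnormZ opnorm_eq0.

End bounded_op_algebra.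

Section banach_algebra_notions.
Variables (R : realType) (H : normedModType R[i]).
Local Notation B := (bounded_op H).

Definition is_inverse (X Y : B) := X * Y = 1 /\ Y * X = 1.

Definition invertible (X : B) := exists Y, is_inverse X Y.

(* Here and below, xget 0 selects the (unique) operator with the given property;
   the default 0 is only reached when there is none. *)
Definition inv_op (X : B) : B := xget 0 [set Y | is_inverse X Y].

Definition spectrum (T : B) : set R[i] :=
  [set z : R[i] | ~ invertible (T - z *: (1 : B))].

Definition spectral_radius (T : B) : R :=
  sup [set complex.Re `|z| | z in spectrum T].

Definition exp_op (A : B) : B :=
  limn (series (fun k => (k`!%:R)^-1 *: A ^+ k)).

Definition poly_op (p : {poly R}) (T : B) : B :=
  \sum_(i < size p) (p`_i)%:C *: T ^+ i.

(* Continuous functional calculus, meant for T self-adjoint (so that its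
   spectrum is real) and f continuous on the spectrum of T: the norm limit of
   p_n(T) for real polynomials p_n converging to f uniformly on the spectrum. *)
Definition is_cfc (f : R -> R) (T Q : B) :=
  exists p : nat -> {poly R},
    {uniform [set t : R | spectrum T t%:C],
      (fun n t => (p n).[t]) @ \oo --> f} /\
    (fun n => poly_op (p n) T) @ \oo --> Q.

Definition cfc (f : R -> R) (T : B) : B := xget 0 [set Q | is_cfc f T Q].

(* Meant for P >= 0 and lam >= 0. Since 0 `^ 0 = 1, the function is constantly 1
   when lam = 0, which gives the convention P^0 = I. *)
Definition pow_op (P : B) (lam : R) : B := cfc (fun t => t `^ lam) P.

End banach_algebra_notions.

Section aluthge.
Variables (R : realType) (H : hilbertType R).
Local Notation B := (bounded_op H).

Definition adjoint (T : B) : B :=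
  xget 0 [set S : B | forall x y, inner (T x) y = inner x (S y)].

Definition self_adjoint (A : B) := adjoint A = A.

Definition abs_op (T : B) : B := pow_op (adjoint T * T) 2^-1.

Definition partial_isometry (U : B) :=
  forall x, (forall y, U y = 0 -> inner x y = 0) -> `|U x| = `|x|.

Definition polar_factor (T : B) : B :=
  xget 0 [set U | [/\ partial_isometry U,
                      forall x, U x = 0 <-> T x = 0 &
                      T = U * abs_op T]].

Definition aluthge (lam : R) (T : B) : B :=
  pow_op (abs_op T) lam * polar_factor T * pow_op (abs_op T) (1 - lam).

End aluthge.

(* Main.v *)
Require Import Defs.
From mathcomp Require Import all_boot all_order all_algebra.
From mathcomp Require Import sesquilinear complex ring lra.
From mathcomp Require Import all_classical all_reals all_analysis.

(* Lower bound: with S = U|S|, the operators Delta(S) = |S|^lam (U |S|^(1-lam))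
   and S = (U |S|^(1-lam)) |S|^lam are the two products of the same pair of
   operators, so they have the same spectral radius; hence
   r(T) = r(Delta^n(X T X^-1)) <= ||Delta^n(X T X^-1)||.

   Upper bound: ||Delta(S)|| <= ||S||^lam ||S||^(1-lam) = ||S||, so it suffices to
   find a self-adjoint A with ||e^A T e^-A|| <= r for every r > r(T).  By the
   spectral radius formula ||T^N|| <= r^N for some N > 0.  Then
   P = sum_(k < N) r^(-2k) (T^k)* T^k satisfies P >= 1 and T* P T <= r^2 P, and
   A = (ln P)/2 works because ||e^A x||^2 = <P x, x>.

   The functional calculus rests on ||p(T)|| <= sup |p| over the spectrum for T
   self-adjoint: ||S|| or -||S|| belongs to the spectrum of a self-adjoint S, which
   is applied to S = p(T) with the spectral mapping theorem for polynomials. *)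

Set Implicit Arguments.
Unset Strict Implicit.
Unset Printing Implicit Defensive.

Import Order.TTheory GRing.Theory Num.Theory.
Import numFieldNormedType.Exports.

Local Open Scope classical_set_scope.
Local Open Scope ring_scope.
Local Open Scope complex_scope.

(** Adjoint, inverse, functional calculus and polar factor are selected by [xget], so each of them
    means something only after an existence proof: the Riesz representation gives the adjoint,
    uniform polynomial approximation gives the calculus, and a strong limit gives the partial
    isometry. The spectral radius formula is proved in an elementary way: the resolvent identity,
    compactness of a disc and the roots of -1 do the work. The inequality T* P T <= r^2 P is a shift
    of the sum: passing from x to T x moves each term to the next one at the price of r^2, and the
    term ||T^N x||^2 that leaves the range is paid for by the term k = 0. A nonzero vector is what
    makes the spectrum of a self-adjoint operator nonempty; the norm estimate of the calculus starts
    from there. *)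

(** * Real-valued norms and sequential limits *)

(** Norms of complex spaces live in [R[i]], whose order is only partial; the real copy makes [lra],
    square roots and suprema applicable. *)
Definition rnorm (R : realType) (V : normedZmodType R[i]) (x : V) : R :=
  complex.Re `|x|.

Section rnorm_zmod.
Variables (R : realType) (V : normedZmodType R[i]).
Implicit Types x y : V.

Lemma rnormE x : (rnorm x)%:C = `|x|.
Proof. exact: normC_Re. Qed.

Lemma rnorm_ge0 x : 0 <= rnorm x.
Proof. by rewrite -lecR rnormE; exact: normr_ge0. Qed.

Lemma ler_rnormD x y : rnorm (x + y) <= rnorm x + rnorm y.
Proof. by rewrite -lecR rmorphD /= !rnormE ler_normD. Qed.

Lemma rnormN x : rnorm (- x) = rnorm x.
Proof. by rewrite /rnorm normrN. Qed.

Lemma rnormB x y : rnorm (x - y) = rnorm (y - x).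
Proof. by rewrite -rnormN opprB. Qed.

Lemma ler_rnormB x y : rnorm (x - y) <= rnorm x + rnorm y.
Proof. by rewrite (le_trans (ler_rnormD _ _))// rnormN. Qed.

Lemma rnorm0 : rnorm (0 : V) = 0.
Proof. by rewrite /rnorm normr0. Qed.

Lemma rnorm_eq0 x : rnorm x = 0 -> x = 0.
Proof. by move=> x0; apply/eqP; rewrite -normr_eq0 -rnormE x0. Qed.

Lemma rnorm_dist x y : `|rnorm x - rnorm y| <= rnorm (x - y).
Proof.
rewrite ler_norml; have := ler_rnormD (x - y) y; have := ler_rnormD (y - x) x.
by rewrite !subrK rnormB => ? ?; apply/andP; split; lra.
Qed.

End rnorm_zmod.

Section rnorm_complex.
Variable R : realType.
Implicit Types z w : R[i].

Lemma rnormCM z w : rnorm (z * w) = rnorm z * rnorm w.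
Proof.
suff : (rnorm (z * w))%:C = (rnorm z * rnorm w)%:C by case.
by rewrite rmorphM /= !rnormE normrM.
Qed.

Lemma rnormCV z : rnorm z^-1 = (rnorm z)^-1.
Proof.
suff : (rnorm z^-1)%:C = (rnorm z)^-1%:C by case.
by rewrite fmorphV /= !rnormE normfV.
Qed.

Lemma rnormCR (a : R) : rnorm a%:C = `|a|.
Proof. by rewrite /rnorm normc_def /= expr0n addr0 sqrtr_sqr. Qed.

End rnorm_complex.

Section rnorm_theory.
Variables (R : realType) (V : normedModType R[i]).
Implicit Types x y : V.

Lemma rnormZ (a : R[i]) x : rnorm (a *: x) = rnorm (a : R[i]) * rnorm x.
Proof.
have : (rnorm (a *: x))%:C = (rnorm (a : R[i]) * rnorm x)%:C.
  by rewrite rmorphM /= !rnormE normrZ.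
by case.
Qed.

Lemma rnormZR (a : R) x : rnorm (a%:C *: x) = `|a| * rnorm x.
Proof. by rewrite rnormZ rnormCR. Qed.

(** Epsilon ranges over [R] instead of [R[i]]; [rcvgP] translates to filter convergence. *)
Definition rcvg (u : nat -> V) (l : V) :=
  forall e : R, 0 < e -> exists N, forall n, (N <= n)%N -> rnorm (u n - l) < e.

Definition rcauchy (u : nat -> V) :=
  forall e : R, 0 < e -> exists N, forall m n, (N <= m)%N -> (N <= n)%N ->
  rnorm (u m - u n) < e.

Lemma rcvgP (u : nat -> V) (l : V) : rcvg u l <-> (u @ \oo --> l).
Proof.
split=> [ul|/cvgrPdist_lt ul].
  apply/cvgrPdist_lt => e e0.
  have /ul[N uN] : 0 < complex.Re e by move: e0; rewrite ltcE => /andP[].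
  exists N => // n /uN; rewrite distrC -ltcR rnormE RRe_real// gtr0_real//.
move=> e e0; have /ul[N _ uN] : 0 < e%:C by rewrite ltcR.
by exists N => n /uN; rewrite -rnormE ltcR rnormB.
Qed.

Lemma rcvg_unique (u : nat -> V) (k l : V) : rcvg u k -> rcvg u l -> k = l.
Proof.
move=> uk ul; apply/eqP; rewrite -subr_eq0; apply/eqP/rnorm_eq0.
apply/eqP; rewrite eq_le rnorm_ge0 andbT leNgt; apply/negP => kl0.
have [N1 u1] := uk _ (divr_gt0 kl0 (ltr0Sn R 1)).
have [N2 u2] := ul _ (divr_gt0 kl0 (ltr0Sn R 1)).
have := u1 _ (leq_maxl N1 N2); have := u2 _ (leq_maxr N1 N2).
set n := maxn _ _ => v1 v2.
have := ler_rnormD (k - u n) (u n - l); rewrite addrA subrK (rnormB k (u n)); lra.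
Qed.

Lemma rcvg_cauchy (u : nat -> V) (l : V) : rcvg u l -> rcauchy u.
Proof.
move=> ul e e0; have [N uN] := ul _ (divr_gt0 e0 (ltr0Sn R 1)).
exists N => m n /uN um /uN un.
have := ler_rnormB (u m - l) (u n - l); rewrite opprB addrA subrK; lra.
Qed.

Lemma rcvg_rnorm (u : nat -> V) (l : V) : rcvg u l ->
  (fun n => rnorm (u n)) @ \oo --> (rnorm l : R).
Proof.
move=> ul; apply/cvgrPdist_lt => e /ul[N uN]; exists N => // n /= /uN.
by rewrite distrC; apply: le_lt_trans; exact: rnorm_dist.
Qed.

Lemma rcvg_cst (l : V) : rcvg (fun=> l) l.
Proof. by move=> e e0; exists 0%N => n _; rewrite subrr rnorm0. Qed.

Lemma rcvgD (u v : nat -> V) (k l : V) :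
  rcvg u k -> rcvg v l -> rcvg (fun n => u n + v n) (k + l).
Proof. by move=> /rcvgP uk /rcvgP vl; apply/rcvgP; exact: (cvgD uk vl). Qed.

Lemma rcvgB (u v : nat -> V) (k l : V) :
  rcvg u k -> rcvg v l -> rcvg (fun n => u n - v n) (k - l).
Proof. by move=> /rcvgP uk /rcvgP vl; apply/rcvgP; exact: (cvgB uk vl). Qed.

Lemma rcvgZ (a : R[i]) (u : nat -> V) (k : V) :
  rcvg u k -> rcvg (fun n => a *: u n) (a *: k).
Proof. by move=> /rcvgP uk; apply/rcvgP; exact: (cvgZr uk). Qed.

Lemma rcvg_le (u : nat -> V) (l : V) (c : R) :
  rcvg u l -> (forall n, rnorm (u n) <= c) -> rnorm l <= c.
Proof.
move=> ul uc; apply/ler_addgt0Pl => e /ul[N /(_ N (leqnn N)) uN].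
have := ler_rnormD (l - u N) (u N); have := uc N.
by rewrite subrK (rnormB l); lra.
Qed.

Lemma rcvg_comp (u : nat -> V) (l : V) (f : nat -> nat) :
  (forall n, n <= f n)%N -> rcvg u l -> rcvg (u \o f) l.
Proof.
move=> fn ul e /ul[N uN]; exists N => n Nn.
by apply: uN; exact: leq_trans (fn n).
Qed.

Lemma rcvg_eq (u v : nat -> V) (l : V) : u =1 v -> rcvg u l -> rcvg v l.
Proof. by move=> uv; rewrite (_ : u = v)//; exact/funext. Qed.

End rnorm_theory.

Lemma rcauchy_cvg (R : realType) (V : completeNormedModType R[i])
  (u : nat -> V) : rcauchy u -> exists l, rcvg u l.
Proof.
move=> cu; have : cvg (u @ \oo).
  apply: cauchy_cvg; apply/cauchy_exP => /= e e0.
  have e20 : 0 < complex.Re e by move: e0; rewrite ltcE => /andP[].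
  have [N uN] := cu _ e20; exists (u N); exists N => // n /= Nn.
  rewrite -ball_normE /ball_/= -rnormE -[e]RRe_real ?gtr0_real// ltcR.
  exact: uN.
by move=> /cvg_ex[l /rcvgP]; exists l.
Qed.

(** * Real inner product, projections and the Riesz representation *)

Section inner_product.
Variables (R : realType) (H : hilbertType R).
Implicit Types x y z : H.

(** A symmetric real bilinear form that keeps all the information: [inner_rdot] recovers the complex
    product from its values at x and at i x. *)
Definition rdot x y : R := complex.Re (inner x y).

Lemma innerC x y : inner y x = (inner x y)^*.
Proof. by rewrite hermC expr0 mul1r. Qed.

Lemma rdotC x y : rdot x y = rdot y x.
Proof. by rewrite /rdot (innerC y x); case: (inner y x). Qed.

Lemma rdotDl x y z : rdot (x + y) z = rdot x z + rdot y z.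
Proof. by rewrite /rdot linearDl raddfD. Qed.

Lemma rdotDr x y z : rdot x (y + z) = rdot x y + rdot x z.
Proof. by rewrite rdotC rdotDl !(rdotC _ x). Qed.

Lemma rdotNl x y : rdot (- x) y = - rdot x y.
Proof. by rewrite /rdot linearNl raddfN. Qed.

Lemma rdotNr x y : rdot x (- y) = - rdot x y.
Proof. by rewrite rdotC rdotNl rdotC. Qed.

Lemma rdotBl x y z : rdot (x - y) z = rdot x z - rdot y z.
Proof. by rewrite rdotDl rdotNl. Qed.

Lemma rdotBr x y z : rdot x (y - z) = rdot x y - rdot x z.
Proof. by rewrite rdotDr rdotNr. Qed.

Lemma rdotZl (a : R) x y : rdot (a%:C *: x) y = a * rdot x y.
Proof. by rewrite /rdot linearZl_LR/=; case: (inner x y) => b c /=; rewrite mul0r subr0. Qed.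

Lemma rdotZr (a : R) x y : rdot x (a%:C *: y) = a * rdot x y.
Proof. by rewrite rdotC rdotZl rdotC. Qed.

Lemma rdot0l x : rdot 0 x = 0.
Proof. by rewrite /rdot linear0l. Qed.

Lemma rdot0r x : rdot x 0 = 0.
Proof. by rewrite rdotC rdot0l. Qed.

Lemma rdotxx x : rdot x x = rnorm x ^+ 2.
Proof. by rewrite /rdot inner_norm -rnormE -rmorphXn. Qed.

Lemma rdot_ri x y : rdot ('i *: x) y = - complex.Im (inner x y).
Proof.
rewrite /rdot linearZl_LR/=; case: (inner x y) => b c /=.
by rewrite mul0r mul1r sub0r.
Qed.

Lemma inner_rdot x y : inner x y = (rdot x y)%:C - 'i * (rdot ('i *: x) y)%:C.
Proof.
by rewrite rdot_ri rmorphN mulrN opprK /rdot {1}[inner x y]complexE.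
Qed.

Lemma rdot_eq_inner x y x' y' : rdot x y = rdot x' y' ->
  rdot ('i *: x) y = rdot ('i *: x') y' -> inner x y = inner x' y'.
Proof. by move=> e1 e2; rewrite inner_rdot e1 e2 -inner_rdot. Qed.

Lemma rdot_ii x y : rdot ('i *: x) ('i *: y) = rdot x y.
Proof.
rewrite /rdot linearZl_LR /= linearZr_LR /= mulrA.
by rewrite -normCK normCi expr1n mul1r.
Qed.

Lemma rnormD_sqr x y :
  rnorm (x + y) ^+ 2 = rnorm x ^+ 2 + 2 * rdot x y + rnorm y ^+ 2.
Proof. by rewrite -!rdotxx rdotDl !rdotDr (rdotC y x); ring. Qed.

Lemma rnormB_sqr x y :
  rnorm (x - y) ^+ 2 = rnorm x ^+ 2 - 2 * rdot x y + rnorm y ^+ 2.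
Proof. by rewrite rnormD_sqr rdotNr rnormN; ring. Qed.

(** Cauchy-Schwarz, by expanding the squared norm of ||y|| x - ||x|| y. *)
Lemma rdot_le x y : rdot x y <= rnorm x * rnorm y.
Proof.
have [->|/eqP y0] := eqVneq y 0; first by rewrite rdot0r rnorm0 mulr0.
have ny : 0 < rnorm y.
  by rewrite lt_neqAle rnorm_ge0 andbT eq_sym; apply/eqP => /rnorm_eq0.
have [->|/eqP x0] := eqVneq x 0; first by rewrite rdot0l rnorm0 mul0r.
have nx : 0 < rnorm x.
  by rewrite lt_neqAle rnorm_ge0 andbT eq_sym; apply/eqP => /rnorm_eq0.
have := sqr_ge0 (rnorm ((rnorm y)%:C *: x - (rnorm x)%:C *: y)).
rewrite rnormB_sqr !rnormZR !ger0_norm ?rnorm_ge0// rdotZl rdotZr => le0.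
have p0 := mulr_gt0 nx ny.
rewrite -(ler_pM2l p0); lra.
Qed.

Lemma rdot_norm_le x y : `|rdot x y| <= rnorm x * rnorm y.
Proof.
by rewrite ler_norml rdot_le andbT lerNl -rdotNl (le_trans (rdot_le _ _))// rnormN.
Qed.

Lemma rdot_eqP x y : (forall z, rdot z x = rdot z y) -> x = y.
Proof.
move=> xy; apply/eqP; rewrite -subr_eq0; apply/eqP/rnorm_eq0/eqP.
by rewrite -sqrf_eq0 -rdotxx rdotBr xy subrr.
Qed.

Lemma rcvg_rdot (u : nat -> H) l y : rcvg u l ->
  (fun n => rdot (u n) y) @ \oo --> (rdot l y : R).
Proof.
move=> ul; apply/cvgrPdist_lt => e e0.
have y0 : 0 < rnorm y + 1 by have := rnorm_ge0 y; lra.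
have [N uN] := ul _ (divr_gt0 e0 y0); exists N => // n /= /uN.
rewrite ltr_pdivlMr// => une; rewrite -rdotBl.
rewrite (le_lt_trans (rdot_norm_le _ _))// (le_lt_trans _ une)// rnormB.
by rewrite ler_wpM2l ?rnorm_ge0//; lra.
Qed.

(** Real scalars suffice for orthogonality with respect to [rdot]; for sets stable under
    multiplication by i, [orthogonal_inner] upgrades it to [inner]. *)
Record closed_subspace (V : set H) : Prop := ClosedSubspace {
  subspace0 : V 0;
  subspaceP : forall (a : R) x y, V x -> V y -> V (a%:C *: x + y);
  subspace_cvg : forall u l, (forall n, V (u n)) -> rcvg u l -> V l }.

Lemma projection_theorem (V : set H) x : closed_subspace V ->
  exists v w, [/\ V v, forall y, V y -> rdot w y = 0 & x = v + w].
Proof.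
move=> [V0 VP Vcvg].
pose D := [set rnorm (x - v) ^+ 2 | v in V]; pose d := inf D.
have D0 : has_inf D.
  split; first by exists (rnorm (x - 0) ^+ 2), 0.
  by exists 0 => _ [v _ <-]; exact: sqr_ge0.
have dV v : V v -> d <= rnorm (x - v) ^+ 2.
  by move=> Vv; apply: ge_inf; [exact: D0.2 | exists v].
have /choice[u uP] n : exists v, V v /\ rnorm (x - v) ^+ 2 < d + n.+1%:R^-1.
  have n0 : 0 < n.+1%:R^-1 :> R by rewrite invr_gt0 ltr0n.
  have [_ [v Vv <-] vd] := inf_adherent n0 D0.
  by exists v.
have invn (e : R) : 0 < e -> exists N, forall n, (N <= n)%N -> n.+1%:R^-1 < e.
  move=> e0; have /cvgrPdist_lt/(_ _ e0)[N _ NP] := @cvg_harmonic R.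
  have i0 n : 0 <= n.+1%:R^-1 :> R by rewrite invr_ge0 ler0n.
  by exists N => n /NP; rewrite /harmonic /= sub0r normrN ger0_norm.
(* Parallelogram identity: the midpoint of u m and u n lies in V, so its squared distance to x is at
   least d. This makes the minimizing sequence Cauchy. *)
have para m n : rnorm (u m - u n) ^+ 2 <= 2 * m.+1%:R^-1 + 2 * n.+1%:R^-1.
  have [Vm um] := uP m; have [Vn un] := uP n.
  have -> : u m - u n = (x - u n) - (x - u m).
    by rewrite opprB [RHS]addrC addrA subrK.
  have := dV ((2^-1)%:C *: (u m + u n)).
  have -> : x - (2^-1)%:C *: (u m + u n) =
      (2^-1)%:C *: ((x - u m) + (x - u n)).
    rewrite !scalerDr !scalerN opprD addrACA -scalerDl -rmorphD /=.
    by rewrite (_ : 2^-1 + 2^-1 = 1 :> R) ?scale1r//; lra.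
  rewrite rnormZR ger0_norm ?invr_ge0// exprMn (rnormB_sqr (x - u n)).
  rewrite (rnormD_sqr (x - u m)) (rdotC (x - u n)) => dle.
  have Vmn : V ((2^-1)%:C *: (u m + u n)).
    rewrite -[X in V X]addr0; apply: (VP) => //.
    by rewrite -(scale1r (u m)); exact: (VP 1).
  have {dle Vmn} := dle Vmn; move: um un.
  by move: (m.+1%:R^-1) (n.+1%:R^-1) => a b; lra.
have cu : rcauchy u.
  move=> e e0; have e2 : 0 < e ^+ 2 / 4 by rewrite divr_gt0 ?exprn_gt0.
  have [N NP] := invn _ e2; exists N => m n /NP Nm /NP Nn.
  rewrite -(@ltr_pXn2r _ 2)// ?nnegrE ?rnorm_ge0 ?(ltW e0)//.
  apply: le_lt_trans (para m n) _; move: Nm Nn.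
  by move: (m.+1%:R^-1) (n.+1%:R^-1) => a b; lra.
have [v uv] := rcauchy_cvg cu.
have Vv : V v by apply: Vcvg uv => n; exact: (uP n).1.
have vd : rnorm (x - v) ^+ 2 <= d.
  have c1 : (fun n => rnorm (x - u n)) @ \oo --> (rnorm (x - v) : R).
    by apply: rcvg_rnorm; apply: rcvgB uv; exact: rcvg_cst.
  apply/ler_addgt0Pl => e /invn[N NP].
  have c2 : (fun n => rnorm (x - u n) ^+ 2) @ \oo --> (rnorm (x - v) ^+ 2 : R).
    by rewrite expr2; under eq_fun do rewrite expr2; exact: cvgM.
  rewrite -(cvg_lim _ c2)//.
  apply: limr_le; first by apply/cvg_ex; eexists; exact: c2.
  by exists N => // n /NP nN /=; have [_] := uP n; move: nN; move: (n.+1%:R^-1) => a; lra.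
exists v, (x - v); split => //; last by rewrite addrC subrK.
move=> y Vy; apply/eqP/negP => /negP xy0.
(* First variation: v is compared with the competitor v + t y. *)
have key t : 0 <= - (2 * t * rdot (x - v) y) + t ^+ 2 * rnorm y ^+ 2.
  have : d <= rnorm (x - (t%:C *: y + v)) ^+ 2 by apply: dV; exact: VP.
  rewrite [t%:C *: y + v]addrC opprD addrA rnormB_sqr rdotZr rnormZR exprMn real_normK ?num_real//.
  by lra.
have c0 : 0 < rnorm y ^+ 2 + 1 by have := sqr_ge0 (rnorm y); lra.
(* A near-optimal t; the + 1 keeps the denominator positive when y = 0. The variation becomes - t^2
   (||y||^2 + 2), which is negative unless t = 0. *)
have := key (rdot (x - v) y / (rnorm y ^+ 2 + 1)).
set r := rdot (x - v) y in xy0 *; set c := rnorm y ^+ 2 in c0 *.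
have -> : - (2 * (r / (c + 1)) * r) + (r / (c + 1)) ^+ 2 * c =
   - (r / (c + 1)) ^+ 2 * (c + 2) by field; lra.
rewrite mulNr oppr_ge0 pmulr_lle0; last by lra.
rewrite leNgt exprn_even_gt0//= mulf_neq0// invr_eq0; lra.
Qed.

Lemma orthogonal_inner (V : set H) w :
  (forall x, V x -> V ('i *: x)) -> (forall y, V y -> rdot w y = 0) ->
  forall y, V y -> inner w y = 0.
Proof.
move=> Vi wV y Vy; rewrite inner_rdot wV// -rdot_ii scalerA.
by rewrite -expr2 sqrCi scaleN1r rdotNl wV ?oppr0 ?mulr0 ?subr0//; exact: Vi.
Qed.

(** If f is not zero, take w orthogonal to its kernel with f w nonzero. Since x - (f x / f w) w lies
    in the kernel, pairing it with w determines f x. *)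
Lemma riesz_representation (f : H -> R) (c : R) :
  (forall x y, f (x + y) = f x + f y) ->
  (forall (a : R) x, f (a%:C *: x) = a * f x) ->
  (forall x, `|f x| <= c * rnorm x) -> exists z, forall x, f x = rdot x z.
Proof.
move=> fD fZ fc; have f0 : f 0 = 0 by rewrite -(scale0r 0) (fZ 0) mul0r.
have [f_eq0|] := pselect (forall x, f x = 0).
  by exists 0 => x; rewrite f_eq0 rdot0r.
move=> /existsNP[x0 /eqP fx0].
have Vc : closed_subspace [set x | f x = 0].
  split => //= [a x y fx fy|u l fu ul]; first by rewrite fD fZ fx fy mulr0 addr0.
  have c0 : 0 < `|c| + 1 by have := normr_ge0 c; lra.
  apply/eqP; rewrite -normr_eq0 eq_le normr_ge0 andbT.
  apply/ler_addgt0Pl => e e0; rewrite addr0.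
  have [N /(_ N (leqnn N)) uN] := ul _ (divr_gt0 e0 c0).
  have -> : f l = f (l - u N) by rewrite -[RHS]addr0 -[X in _ = _ + X](fu N) -fD subrK.
  move: uN; rewrite ltr_pdivlMr// rnormB => uN; apply: le_trans (fc _) _.
  have := ler_norm c; have := rnorm_ge0 (l - u N).
  by move=> r0 ?; apply: le_trans (ltW uN); rewrite mulrC ler_wpM2l//; lra.
have [v [w [/= fv wV xvw]]] := projection_theorem x0 Vc.
have fw : f w != 0 by apply: contra fx0 => /eqP fw; rewrite xvw fD fv fw addr0.
have w0 : rdot w w != 0.
  rewrite rdotxx sqrf_eq0; apply: contra fw => /eqP/rnorm_eq0 ->.
  by rewrite f0.
exists ((f w / rdot w w)%:C *: w) => x; rewrite rdotZr rdotC.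
have /wV : f ((- (f x / f w))%:C *: w + x) = 0.
  by rewrite fD fZ mulNr divfK// addNr.
rewrite rdotDr rdotZr => e.
have -> : rdot w x = f x / f w * rdot w w by lra.
by field; apply/andP.
Qed.

End inner_product.

(** * Bounded operators *)

Section bounded_operators.
Variables (R : realType) (H : normedModType R[i]).
Local Notation B := (bounded_op H).
Implicit Types (S T X : B) (x y : H).

Lemma opE_mul S T x : (S * T) x = S (T x). Proof. by []. Qed.
Lemma opE1 x : (1 : B) x = x. Proof. by []. Qed.
Lemma opE0 x : (0 : B) x = 0. Proof. by []. Qed.
Lemma opED S T x : (S + T) x = S x + T x. Proof. by []. Qed.
Lemma opEN S x : (- S) x = - S x. Proof. by []. Qed.
Lemma opEB S T x : (S - T) x = S x - T x. Proof. by []. Qed.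
Lemma opEZ a S x : (a *: S) x = a *: S x. Proof. by []. Qed.
Definition opE := (opE_mul, opE1, opE0, opEB, opED, opEN, opEZ).

Lemma op_zero T : T 0 = 0. Proof. exact: linear0. Qed.
Lemma op_add T x y : T (x + y) = T x + T y. Proof. exact: linearD. Qed.
Lemma op_sub T x y : T (x - y) = T x - T y. Proof. exact: linearB. Qed.
Lemma op_scale a T x : T (a *: x) = a *: T x. Proof. exact: linearZ. Qed.

Lemma opE_sum I (r : seq I) (P : pred I) (F : I -> B) x :
  (\sum_(i <- r | P i) F i) x = \sum_(i <- r | P i) F i x.
Proof. by elim/big_ind2 : _ => // S y T z <- <-. Qed.

Lemma scale_mull a S T : (a *: S) * T = a *: (S * T).
Proof. exact: bounded_op_ext. Qed.

Lemma scale_mulr a S T : S * (a *: T) = a *: (S * T).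
Proof. by apply: bounded_op_ext => x; rewrite !opE linearZ. Qed.

Lemma rnorm_op T : rnorm T = opnorm T.
Proof. by []. Qed.

Lemma opnorm_rnorm T x : rnorm (T x) <= opnorm T * rnorm x.
Proof. by rewrite -lecR rmorphM /= !rnormE; exact: opnormP. Qed.

Lemma opnorm_le_rnorm T (M : R) : 0 <= M ->
  (forall x, rnorm (T x) <= M * rnorm x) -> opnorm T <= M.
Proof.
move=> M0 TM; apply: opnorm_le => x x1; rewrite -rnormE lecR.
apply: le_trans (TM x) _; rewrite ler_piMr//.
by rewrite -lecR rnormE.
Qed.

Lemma opnormM S T : opnorm (S * T) <= opnorm S * opnorm T.
Proof.
apply: opnorm_le_rnorm => [|x]; first by rewrite mulr_ge0// opnorm_ge0.
rewrite opE -mulrA (le_trans (opnorm_rnorm _ _))// ler_wpM2l ?opnorm_ge0//.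
exact: opnorm_rnorm.
Qed.

Lemma opnorm_leD S T : opnorm (S + T) <= opnorm S + opnorm T.
Proof. by rewrite -!rnorm_op; exact: ler_rnormD. Qed.

Lemma opnorm_dist S T X : opnorm (S - X) <= opnorm (S - T) + opnorm (T - X).
Proof. by apply: le_trans (opnorm_leD _ _); rewrite addrA subrK. Qed.

Lemma opnormN T : opnorm (- T) = opnorm T.
Proof. by rewrite -!rnorm_op rnormN. Qed.

Lemma opnormB S T : opnorm (S - T) = opnorm (T - S).
Proof. by rewrite -opnormN opprB. Qed.

Lemma opnorm1_le : opnorm (1 : B) <= 1.
Proof. by apply: opnorm_le_rnorm => // x; rewrite mul1r. Qed.

Lemma linear_op_exists (f : H -> H) (M : R) : linear f ->
  (forall x, rnorm (f x) <= M * rnorm x) -> exists T : B, T =1 f.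
Proof.
move=> lf fM; suff bf : f \in @bounded_op_pred R H by exists (BoundedOp bf).
apply/asboolP; split => // x; apply/cvgrPdist_lt => e e0.
have e20 : 0 < complex.Re e by move: e0; rewrite ltcE => /andP[].
have M0 : 0 < `|M| + 1 by have := normr_ge0 M; lra.
have d0 : 0 < (complex.Re e / (`|M| + 1))%:C by rewrite ltcR divr_gt0.
apply: filterS (nbhsx_ballx x _ d0) => y.
rewrite -ball_normE /ball_/= -!rnormE -[e]RRe_real ?gtr0_real// !ltcR ltr_pdivlMr//.
have -> : f x - f y = f (x - y).
  by rewrite [x - y]addrC -(scaleN1r y) lf scaleN1r addrC.
apply: le_lt_trans; apply: le_trans (fM _) _; rewrite mulrC ler_wpM2l ?rnorm_ge0//.
by have := ler_norm M; lra.
Qed.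

Lemma rcvg_op T (u : nat -> H) l : rcvg u l -> rcvg (fun n => T (u n)) (T l).
Proof.
move=> ul e e0; have T0 : 0 < opnorm T + 1 by have := opnorm_ge0 T; lra.
have [N uN] := ul _ (divr_gt0 e0 T0); exists N => n /uN.
rewrite ltr_pdivlMr// -linearB mulrC; apply: le_lt_trans.
apply: le_trans (opnorm_rnorm _ _) _; rewrite ler_wpM2r ?rnorm_ge0//; lra.
Qed.

Lemma rcvg_opE (u : nat -> B) T x : rcvg u T -> rcvg (fun n => u n x) (T x).
Proof.
move=> uT e e0; have x0 : 0 < rnorm x + 1 by have := rnorm_ge0 x; lra.
have [N uN] := uT _ (divr_gt0 e0 x0); exists N => n /uN.
rewrite ltr_pdivlMr// -opEB rnorm_op => ux.
apply: le_lt_trans (opnorm_rnorm _ _) _; apply: le_lt_trans ux.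
rewrite ler_wpM2l ?opnorm_ge0//; lra.
Qed.

Lemma rcvgM (u v : nat -> B) S T :
  rcvg u S -> rcvg v T -> rcvg (fun n => u n * v n) (S * T).
Proof.
move=> uS vT e e0.
have S0 : 0 < opnorm S + 1 by have := opnorm_ge0 S; lra.
have T0 : 0 < opnorm T + 1 by have := opnorm_ge0 T; lra.
have e20 : 0 < e / 2 by lra.
have [N1 u1] := uS _ (divr_gt0 e20 T0).
have [N2 u2] := uS _ ltr01.
have [N3 v3] := vT _ (divr_gt0 e20 S0).
exists (maxn N1 (maxn N2 N3)) => n; rewrite !geq_max => /and3P[/u1 n1 /u2 n2 /v3 n3].
have -> : u n * v n - S * T = u n * (v n - T) + (u n - S) * T.
  by rewrite mulrBr mulrBl addrA subrK.
move: n1 n3; rewrite !ltr_pdivlMr// !rnorm_op => n1 n3.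
apply: le_lt_trans (opnorm_leD _ _) _.
have un : opnorm (u n) <= opnorm S + 1.
  have := ler_rnormD (u n - S) S; rewrite subrK !rnorm_op in n2 *; lra.
have := opnormM (u n) (v n - T); have := opnormM (u n - S) T.
have : opnorm (u n) * opnorm (v n - T) <= (opnorm S + 1) * opnorm (v n - T).
  by rewrite ler_wpM2r ?opnorm_ge0.
have := opnorm_ge0 (u n - S); have := opnorm_ge0 (v n - T); lra.
Qed.

End bounded_operators.

(** The uniform bound passes to the pointwise limit and makes it continuous. Completeness in
    operator norm is deduced from this, and the polar factor is obtained as such a strong limit. *)
Lemma rcauchy_strong (R : realType) (H : completeNormedModType R[i])
    (u : nat -> bounded_op H) (M : R) :
  (forall n, opnorm (u n) <= M) -> (forall x, rcauchy (fun n => u n x)) ->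
  exists T : bounded_op H, forall x, rcvg (fun n => u n x) (T x).
Proof.
move=> uM cu; have /choice[f fP] x := rcauchy_cvg (cu x).
have lf : linear f.
  move=> a x y; apply: (rcvg_unique (fP (a *: x + y))).
  apply: (@rcvg_eq _ _ (fun n => a *: u n x + u n y)).
    by move=> n; rewrite linearP.
  by apply: rcvgD => //; exact: rcvgZ.
have [|T Tf] := linear_op_exists (M := M) lf; last by exists T => x; rewrite Tf.
move=> x; apply: rcvg_le (fP x) _ => n.
apply: le_trans (opnorm_rnorm _ _) _; rewrite ler_wpM2r ?rnorm_ge0//.
Qed.

Lemma rcauchy_op (R : realType) (H : completeNormedModType R[i])
  (u : nat -> bounded_op H) : rcauchy u -> exists T, rcvg u T.
Proof.
move=> cu; have [N0 uN0] := cu _ ltr01.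
(* The shift by N0 turns an eventual bound into a bound on all terms. *)
have [||T uT] := @rcauchy_strong _ _ (fun n => u (n + N0)%N) (opnorm (u N0) + 1).
- move=> n; have := ler_rnormD (u (n + N0)%N - u N0) (u N0).
  by rewrite subrK !rnorm_op; have := uN0 (n + N0)%N N0 (leq_addl _ _) (leqnn _);
    rewrite rnorm_op; lra.
- move=> x e e0; have x0 : 0 < rnorm x + 1 by have := rnorm_ge0 x; lra.
  have [N uN] := cu _ (divr_gt0 e0 x0); exists N => m n Nm Nn.
  have := uN (m + N0)%N (n + N0)%N (leq_trans Nm (leq_addr _ _))
    (leq_trans Nn (leq_addr _ _)).
  rewrite ltr_pdivlMr// -opEB rnorm_op => ux.
  apply: le_lt_trans (opnorm_rnorm _ _) _; apply: le_lt_trans ux.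
  rewrite ler_wpM2l ?opnorm_ge0//; lra.
exists T => e e0; have e20 : 0 < e / 2 by lra.
have [N uN] := cu _ e20; exists N => n Nn.
apply: (@le_lt_trans _ _ (e / 2)); last by lra.
apply: opnorm_le_rnorm; first by lra.
move=> x; rewrite opE.
(* [rcvg_le] wants its bound at every index, hence [maxn m N]. *)
apply: (@rcvg_le _ _ (fun m => u n x - u (maxn m N + N0)%N x)).
  apply: rcvgB; first exact: rcvg_cst.
  by apply: (@rcvg_comp _ _ (fun m => u (m + N0)%N x) _ (fun m => maxn m N)) => // m;
    exact: leq_maxl.
move=> m; rewrite -opEB (le_trans (opnorm_rnorm _ _))// ler_wpM2r ?rnorm_ge0//.
by apply/ltW/uN => //; rewrite (leq_trans (leq_maxr m N))// leq_addr.
Qed.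

(** * Invertibility and the spectral radius *)

Lemma expr_lt_eventually (R : realType) (q e : R) : 0 <= q -> q < 1 -> 0 < e ->
  exists N, forall n, (N <= n)%N -> q ^+ n < e.
Proof.
move=> q0 q1 e0; have : `|q| < 1 by rewrite ger0_norm.
move=> /cvg_expr/cvgrPdist_lt/(_ _ e0)[N _ NP]; exists N => n /NP.
by rewrite /= sub0r normrN ger0_norm ?exprn_ge0.
Qed.

Section inverses.
Variables (R : realType) (H : normedModType R[i]).
Local Notation B := (bounded_op H).
Implicit Types (S T X Y Z : B).

Lemma is_inverse_unique X Y Z : is_inverse X Y -> is_inverse X Z -> Y = Z.
Proof. by move=> [XY YX] [XZ ZX]; rewrite -[Y]mulr1 -XZ mulrA YX mul1r. Qed.

Lemma inv_opP X : invertible X -> is_inverse X (inv_op X).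
Proof. by move=> [Y XY]; rewrite /inv_op; case: xgetP => [Z -> //|/(_ Y)]. Qed.

Lemma is_inverse_inv_op X Y : is_inverse X Y -> inv_op X = Y.
Proof. by move=> XY; apply/esym/(is_inverse_unique XY); apply: inv_opP; exists Y. Qed.

Lemma is_inverse_sym X Y : is_inverse X Y -> is_inverse Y X.
Proof. by case. Qed.

Lemma is_inverseM X X' Y Y' :
  is_inverse X X' -> is_inverse Y Y' -> is_inverse (X * Y) (Y' * X').
Proof.
move=> [XX' X'X] [YY' Y'Y]; split.
  by rewrite mulrA -(mulrA X) YY' mulr1.
by rewrite mulrA -(mulrA Y') X'X mulr1.
Qed.

Lemma invertible1 : invertible (1 : B).
Proof. by exists 1; split; rewrite mulr1. Qed.

Lemma invertibleM X Y : invertible X -> invertible Y -> invertible (X * Y).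
Proof. by move=> [X' XX'] [Y' YY']; exists (Y' * X'); exact: is_inverseM. Qed.

Lemma is_inverseZ (a : R[i]) X Y : a != 0 -> is_inverse X Y ->
  is_inverse (a *: X) (a^-1 *: Y).
Proof.
by move=> a0 [XY YX]; split;
  rewrite scale_mull scale_mulr scalerA ?XY ?YX ?divff ?mulVf// scale1r.
Qed.

Lemma invertibleZ (a : R[i]) X : a != 0 -> invertible X -> invertible (a *: X).
Proof. by move=> a0 [Y XY]; exists (a^-1 *: Y); exact: is_inverseZ. Qed.

Lemma expZn (a : R[i]) T n : (a *: T) ^+ n = a ^+ n *: T ^+ n.
Proof.
elim: n => [|n IH]; first by rewrite !expr0 scale1r.
by rewrite !exprS IH scale_mull scale_mulr scalerA.
Qed.

Lemma inverse_perturbation X X' Y Y' : is_inverse X X' -> is_inverse Y Y' ->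
  Y' - X' = Y' * (X - Y) * X'.
Proof.
by move=> [XX' X'X] [YY' Y'Y]; rewrite mulrBr Y'Y mulrBl mul1r -mulrA XX' mulr1.
Qed.

(** Partial fractions: 1/(1 - x^2) = (1/(1 - x) + 1/(1 + x))/2. This is the doubling step from the
    power 2^m to 2^(m+1). *)
Lemma inverse_one_sub_square X Y Z :
  is_inverse (1 - X) Y -> is_inverse (1 + X) Z ->
  is_inverse (1 - X ^+ 2) ((2^-1)%:C *: (Y + Z)).
Proof.
move=> [XY YX] [XZ ZX].
have e1 : 1 - X ^+ 2 = (1 + X) * (1 - X).
  by rewrite mulrDl mul1r mulrBr mulr1 addrA subrK.
have e2 : 1 - X ^+ 2 = (1 - X) * (1 + X).
  by rewrite mulrBl mul1r mulrDr mulr1 opprD addrA addrK.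
have two : (2^-1)%:C *: ((1 + X) + (1 - X)) = 1.
  rewrite addrACA subrr addr0 scalerDr -scalerDl -rmorphD /=.
  by rewrite (_ : 2^-1 + 2^-1 = 1 :> R) ?scale1r//; lra.
split.
  rewrite scale_mulr mulrDr {1}e1 e2 -!mulrA XY XZ !mulr1.
  exact: two.
rewrite scale_mull mulrDl {1}e2 e1 !mulrA YX ZX !mul1r.
exact: two.
Qed.

(** From 1 - Y = (X - 1) Y one gets ||Y - 1|| <= q ||Y|| <= q (||Y - 1|| + 1), to be solved for ||Y
    - 1||. *)
Lemma opnorm_inverse_near1 X Y (q : R) : is_inverse X Y -> q < 1 ->
  opnorm (X - 1) <= q -> opnorm (Y - 1) <= q / (1 - q).
Proof.
move=> [XY YX] q1 Xq.
have YE : 1 - Y = (X - 1) * Y by rewrite mulrBl XY mul1r.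
have Y1 : opnorm (Y - 1) <= q * opnorm Y.
  rewrite opnormB YE (le_trans (opnormM _ _))//.
  by rewrite ler_wpM2r ?opnorm_ge0.
have Yle : opnorm Y <= opnorm (Y - 1) + 1.
  by rewrite -{1}(subrK 1 Y) (le_trans (opnorm_leD _ _))// lerD2l opnorm1_le.
have q0 : 0 <= q by apply: le_trans Xq; exact: opnorm_ge0.
rewrite ler_pdivlMr ?subr_gt0// mulrBr mulr1 lerBlDr mulrC.
by rewrite (le_trans Y1)// -{2}(mulr1 q) -mulrDr ler_wpM2l// addrC.
Qed.

Lemma opnorm_average S T X Y (c : R) : opnorm (S - X) <= c ->
  opnorm (T - Y) <= c ->
  opnorm ((2^-1)%:C *: (S + T) - (2^-1)%:C *: (X + Y)) <= c.
Proof.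
move=> SX TY; rewrite -scalerBr -rnorm_op rnormZR ger0_norm ?invr_ge0//.
rewrite opprD addrACA rnorm_op.
have := opnorm_leD (S - X) (T - Y); lra.
Qed.

(** The constants chain up: 1/5 gives ||X' - 1|| <= (1/5)/(4/5) = 1/4, the perturbation raises it to
    ||Y' - 1|| <= 1/2, and inverting back gives ||Y|| <= (1/2)/(1/2) = 1. *)
Lemma opnorm_le1_of_inverse X Y X' Y' : is_inverse (1 - X) X' ->
  is_inverse (1 - Y) Y' -> opnorm X <= 5^-1 -> opnorm (Y' - X') <= 4^-1 ->
  opnorm Y <= 1.
Proof.
move=> XX' YY' X5 XY4.
have subE (Z : B) : opnorm (1 - Z - 1) = opnorm Z.
  by rewrite addrAC subrr add0r opnormN.
have X'1 : opnorm (X' - 1) <= 4^-1.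
  have -> : 4^-1 = 5^-1 / (1 - 5^-1) :> R by field; lra.
  by apply: opnorm_inverse_near1 XX' _ _; [lra|rewrite subE].
have Y'1 : opnorm (Y' - 1) <= 2^-1.
  apply: le_trans (opnorm_dist _ X' _) _; lra.
have half1 : 2^-1 / (1 - 2^-1) = 1 :> R by field; lra.
rewrite -subE -[X in _ <= X]half1.
by apply: opnorm_inverse_near1 (is_inverse_sym YY') _ Y'1; lra.
Qed.

End inverses.

Section banach.
Variables (R : realType) (H : completeNormedModType R[i]).
Local Notation B := (bounded_op H).
Implicit Types (S T X Y Z : B).

(** With K = 1 - X, the partial sums of the Neumann series are the iterates of Y |-> 1 + K Y from 0.
    The limit is a fixed point, hence a right inverse; it commutes with K because the iterates do,
    hence it is also a left inverse. *)
Lemma neumann X : opnorm (1 - X) < 1 -> invertible X.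
Proof.
have [K ->] : exists K : B, X = 1 - K by exists (1 - X); rewrite opprB addrC subrK.
rewrite opprB addrC subrK; set q := opnorm K => q1.
have q0 : 0 <= q by exact: opnorm_ge0.
pose u n := iter n (fun Y => 1 + K * Y) (0 : B).
have uC n : opnorm (u n) <= (1 - q)^-1.
  elim: n => [|n IH]; first by rewrite -rnorm_op rnorm0 invr_ge0; lra.
  rewrite /= (le_trans (opnorm_leD _ _))//.
  have := opnorm1_le H; have := opnormM K (u n).
  have : q * opnorm (u n) <= q * (1 - q)^-1 by rewrite ler_wpM2l.
  have -> : q * (1 - q)^-1 = (1 - q)^-1 - 1 by field; lra.
  rewrite -/q; lra.
have du n d : opnorm (u (n + d)%N - u n) <= q ^+ n * (1 - q)^-1.
  elim: n => [|n IH]; first by rewrite subr0 mul1r; exact: uC.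
  rewrite addSn [u _]/= [u n.+1]/= opprD addrACA subrr add0r -mulrBr.
  rewrite (le_trans (opnormM _ _))// exprS -mulrA ler_wpM2l//.
have [Y uY] : exists Y, rcvg u Y.
  apply: rcauchy_op => e e0.
  have q10 : 0 < 1 - q by lra.
  have [N NP] := expr_lt_eventually q0 q1 (mulr_gt0 (divr_gt0 e0 (ltr0Sn R 1)) q10).
  exists N => m n Nm Nn.
  have uN k : (N <= k)%N -> opnorm (u k - u N) < e / 2.
    move=> Nk; rewrite -(subnKC Nk) (le_lt_trans (du _ _))//.
    by rewrite ltr_pdivrMr//; exact: NP.
  rewrite rnorm_op (splitr e) (le_lt_trans (opnorm_dist _ (u N) _))//.
  by rewrite ltrD ?uN// opnormB uN.
have uS : rcvg (fun n => 1 + K * u n) Y.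
  by apply: (rcvg_comp (f := S)) uY => n; exact: leqnSn.
have YE : Y = 1 + K * Y.
  apply: rcvg_unique uS _; apply: rcvgD; first exact: rcvg_cst.
  by apply: rcvgM; [exact: rcvg_cst|exact: uY].
have uK n : u n * K = K * u n.
  elim: n => [|n IH]; first by rewrite [u _]/= mul0r mulr0.
  by rewrite [u _]/= mulrDl mulrDr mul1r mulr1 -mulrA IH.
have YK : Y * K = K * Y.
  apply: (@rcvg_unique _ _ (fun n => u n * K)).
    by apply: rcvgM; [exact: uY|exact: rcvg_cst].
  apply: (@rcvg_eq _ _ (fun n => K * u n)) => //.
  by apply: rcvgM; [exact: rcvg_cst|exact: uY].
exists Y; split; first by rewrite mulrBl mul1r {1}YE addrK.
by rewrite mulrBr mulr1 YK {1}YE addrK.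
Qed.

Lemma spectrum_le_opnorm T (z : R[i]) : spectrum T z -> rnorm z <= opnorm T.
Proof.
move=> Tz; rewrite leNgt; apply/negP => zT; apply: Tz.
have z0 : z != 0.
  apply: contraTneq zT => ->; rewrite -leNgt /rnorm normr0; exact: opnorm_ge0.
have -> : T - z *: (1 : B) = - z *: (1 - z^-1 *: T).
  by rewrite scalerBr scalerA mulNr divff// scaleN1r opprK scaleNr addrC.
apply: invertibleZ; first by rewrite oppr_eq0.
apply: neumann; rewrite opprB addrC subrK -rnorm_op rnormZ rnorm_op.
have zp : 0 < rnorm z by apply: le_lt_trans zT; exact: opnorm_ge0.
by rewrite rnormCV mulrC ltr_pdivrMr// mul1r.
Qed.

Lemma has_ubound_spectrum T : has_ubound [set complex.Re `|z| | z in spectrum T].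
Proof. by exists (opnorm T) => _ [z /spectrum_le_opnorm Tz <-]. Qed.

Lemma spectral_radius_ge0 T : 0 <= spectral_radius T.
Proof.
have [[z Tz]|/set0P/negP] := pselect (exists z, spectrum T z).
  apply: le_trans (rnorm_ge0 z) _.
  by apply: ub_le_sup; [exact: has_ubound_spectrum|exists z].
rewrite negbK => /eqP T0; rewrite /spectral_radius T0 image_set0 sup0//.
Qed.

Lemma le_spectral_radius T (z : R[i]) : spectrum T z -> rnorm z <= spectral_radius T.
Proof.
by move=> Tz; apply: ub_le_sup; [exact: has_ubound_spectrum|exists z].
Qed.

Lemma spectral_radius_le T (c : R) : 0 <= c ->
  (forall z : R[i], spectrum T z -> rnorm z <= c) -> spectral_radius T <= c.
Proof.
move=> c0 Tc; have [[z Tz]|/set0P/negP] := pselect (exists z, spectrum T z).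
  apply: ge_sup; first by exists (complex.Re `|z|), z.
  by move=> _ [w /Tc wc <-].
rewrite negbK => /eqP T0; rewrite /spectral_radius T0 image_set0 sup0//.
Qed.

Lemma spectral_radius_le_opnorm T : spectral_radius T <= opnorm T.
Proof.
apply: spectral_radius_le; first exact: opnorm_ge0.
by move=> z; exact: spectrum_le_opnorm.
Qed.

(* Over 0 the spectra of S T and T S may differ, but the supremum of moduli is
   not affected, even when it is the junk value [sup set0 = 0]. *)
Lemma spectral_radiusC S T : spectral_radius (S * T) = spectral_radius (T * S).
Proof.
suff le (X Y : B) : spectral_radius (X * Y) <= spectral_radius (Y * X).
  by apply/eqP; rewrite eq_le !le.
apply: spectral_radius_le; first exact: spectral_radius_ge0.
move=> z XYz; have [->|z0] := eqVneq z 0.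
  by rewrite /rnorm normr0 spectral_radius_ge0.
apply: le_spectral_radius => -[Z [h1 h2]]; apply: XYz.
(* Jacobson's formula: (X Y - z)^-1 = z^-1 (X (Y X - z)^-1 Y - 1). *)
exists (z^-1 *: (X * Z * Y - 1)); split.
  rewrite scale_mulr mulrBr mulr1 mulrA.
  have -> : (X * Y - z *: (1 : B)) * (X * Z) = X * ((Y * X - z *: (1 : B)) * Z).
    by rewrite mulrA [in RHS]mulrA mulrBr mulrBl scale_mull mul1r scale_mulr mulr1 !mulrA.
  rewrite h1 mulr1 opprB addrC subrK scalerA mulVf// scale1r//.
rewrite scale_mull mulrBl mul1r -!mulrA.
have -> : Y * (X * Y - z *: (1 : B)) = (Y * X - z *: (1 : B)) * Y.
  by rewrite mulrBr mulrBl scale_mull mul1r scale_mulr mulr1 mulrA.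
rewrite (mulrA Z) h2 mul1r opprB addrC subrK scalerA mulVf// scale1r//.
Qed.

Lemma spectral_radius_similar X T : invertible X ->
  spectral_radius (X * T * inv_op X) = spectral_radius T.
Proof.
move=> /inv_opP[_ h]; rewrite spectral_radiusC mulrA h mul1r//.
Qed.

(** Compactness of the disc, by contradiction: parameters w_n with inverses of norm above n
    accumulate at some z of the disc, and the resolvent identity near z bounds these inverses by
    twice the norm of the inverse at z. *)
Lemma resolvent_bounded T (s : R) :
  (forall w : R[i], rnorm w <= s -> invertible (1 - w *: T)) ->
  exists K : R, forall w : R[i], rnorm w <= s -> opnorm (inv_op (1 - w *: T)) <= K.
Proof.
move=> Ts; apply: contrapT => /forallNP K.
have /choice[w wP] (n : nat) : exists w : R[i], rnorm w <= s /\
    n%:R < opnorm (inv_op (1 - w *: T)).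
  have /existsNP[w /not_implyP[ws /negP]] := K n%:R.
  by rewrite -ltNge => nw; exists w.
have Re_le (z : R[i]) : `|complex.Re z| <= rnorm z.
  rewrite /rnorm normc_def /= -sqrtr_sqr ler_wsqrtr// lerDl sqr_ge0//.
have Im_le (z : R[i]) : `|complex.Im z| <= rnorm z.
  rewrite /rnorm normc_def /= -sqrtr_sqr ler_wsqrtr// lerDr sqr_ge0//.
have bnd (v : nat -> R) : (forall n, `|v n| <= s) -> bounded_fun v.
  move=> vs; exists s; split; first exact: num_real.
  by move=> M sM n _; exact: le_trans (vs n) (ltW sM).
(* Two extractions: the real parts, then the imaginary parts along the first subsequence. *)
have [f f_incr f_cvg] := bolzano_weierstrass
  (bnd _ (fun n => le_trans (Re_le _) (wP n).1)).
have [g g_incr g_cvg] := bolzano_weierstrass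
  (bnd _ (fun n => le_trans (Im_le _) (wP (f n)).1)).
have incr_ge (h : nat -> nat) : increasing_seq h -> forall n, (n <= h n)%N.
  move=> hi; elim=> // n IH; apply: leq_ltn_trans IH _.
  have : (h n < h n.+1)%O by rewrite (leW_mono hi) ltEnat /=.
  by rewrite ltEnat.
pose v n := w (f (g n)).
have [a va] : exists a : R, (fun n => complex.Re (v n)) @ \oo --> a.
  exists (limn (fun n => complex.Re (w (f n)))).
  apply: (@cvg_comp _ _ _ g (fun n => complex.Re (w (f n))) _ \oo) => //.
  apply/cvgnyPge => N; exists N => // n /= Nn.
  exact: leq_trans (incr_ge _ g_incr n).
have [b vb] : exists b : R, (fun n => complex.Im (v n)) @ \oo --> b.
  by exists (limn (fun n => complex.Im (v n))); exact: g_cvg.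
pose z : R[i] := a +i* b.
have rn (y : R[i]) : rnorm y <= `|complex.Re y| + `|complex.Im y|.
  rewrite {1}[y]complexE.
  apply: le_trans (ler_rnormD _ _) _.
  rewrite rnormCM !rnormCR.
  suff -> : rnorm ('i : R[i]) = 1 by rewrite mul1r.
  by rewrite /rnorm normc_def /= expr0n add0r expr1n sqrtr1.
have vz (e : R) : 0 < e -> exists N, forall n, (N <= n)%N -> rnorm (v n - z) < e.
  move=> e0; have e20 : 0 < e / 2 by lra.
  move/cvgrPdist_lt : va => /(_ _ e20)[N1 _ h1].
  move/cvgrPdist_lt : vb => /(_ _ e20)[N2 _ h2].
  exists (maxn N1 N2) => n; rewrite geq_max => /andP[/h1/= v1 /h2/= v2].
  apply: le_lt_trans (rn _) _; move: v1 v2; rewrite !raddfB/= distrC.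
  by rewrite [X in _ -> X < _ -> _]distrC; lra.
have zs : rnorm z <= s.
  apply/ler_addgt0Pl => e /vz[N /(_ N (leqnn N)) vN].
  have := ler_rnormD (z - v N) (v N); rewrite subrK rnormB.
  have := (wP (f (g N))).1; rewrite -/(v N); lra.
have := inv_opP (Ts _ zs); set Z := inv_op _ => Zi.
(* Once |v n - z| < 1/(2 (c + 1)), the resolvent identity gives ||Y - Z|| <= ||Y||/2, hence ||Y|| <=
   2 ||Z||. *)
pose c := opnorm T * opnorm Z.
have c0 : 0 < 2 * (c + 1).
  by rewrite mulr_gt0// ltr_wpDl// mulr_ge0// opnorm_ge0.
have ci : 0 < (2 * (c + 1))^-1 by rewrite invr_gt0.
have [N vN] := vz _ ci.
have [M MZ] : exists M : nat, 2 * opnorm Z < M%:R.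
  by exists (Num.truncn (2 * opnorm Z)).+1; apply: Num.Theory.real_truncnS_gt; exact: num_real.
pose n := maxn N M.
have nN : rnorm (v n - z) < (2 * (c + 1))^-1 by apply: vN; exact: leq_maxl.
have [ws] := wP (f (g n)); rewrite -/(v n) in ws *.
have := inv_opP (Ts _ ws); set Y := inv_op _ => Yi.
have := inverse_perturbation Zi Yi.
have -> : 1 - z *: T - (1 - v n *: T) = (v n - z) *: T.
  by rewrite opprB addrC addrA subrK scalerBl.
rewrite scale_mulr scale_mull -mulrA => YZ.
have : opnorm (Y - Z) <= rnorm (v n - z) * (opnorm Y * c).
  rewrite YZ -rnorm_op rnormZ rnorm_op ler_wpM2l ?rnorm_ge0//.
  rewrite (le_trans (opnormM _ _))// ler_wpM2l ?opnorm_ge0// opnormM//.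
have : rnorm (v n - z) * (opnorm Y * c) <= 2^-1 * opnorm Y.
  have : rnorm (v n - z) * c <= 2^-1.
    have : rnorm (v n - z) * c <= (2 * (c + 1))^-1 * c.
      by rewrite ler_wpM2r ?(ltW nN)// mulr_ge0// opnorm_ge0.
    move=> /le_trans; apply; rewrite ler_pdivrMl//; lra.
  by move=> /(ler_wpM2r (opnorm_ge0 Y)); rewrite -mulrA (mulrC c).
have := opnorm_leD (Y - Z) Z; rewrite subrK => Y1 Y2 Y3 Y4.
have : ((f (g n))%:R : R) <= 2 * opnorm Z by lra.
apply/negP; rewrite -ltNge (lt_le_trans MZ)// ler_nat.
apply: leq_trans (leq_maxr N M) _.
apply: leq_trans (incr_ge _ g_incr n) _; exact: incr_ge.
Qed.

(** Such a zeta rewrites 1 + (w T)^(2^m) as 1 - (zeta w T)^(2^m) with |zeta w| = |w|, so both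
    factors of 1 - (w T)^(2^(m+1)) have the same form on the same disc. *)
Lemma root_minus1 (m : nat) : exists2 zeta : R[i],
  zeta ^+ (2 ^ m) = -1 & rnorm zeta = 1.
Proof.
have m0 : (0 < 2 ^ m)%N by rewrite expn_gt0.
exists ((2 ^ m)%N.-root (-1)); first exact: rootCK.
suff : `|(2 ^ m)%N.-root (-1)| == 1 :> R[i] by rewrite /rnorm => /eqP ->.
by rewrite -(pexpr_eq1 m0)// -normrX rootCK// normrN1.
Qed.

(* Spectral radius formula after Rickart: the resolvent averages
   [(1 - (w T)^(2^m))^-1] are equi-Lipschitz in [w], so convergence of
   [(t T)^(2^m)] to 0 propagates to larger [t] by steps of fixed length. *)
Section rickart.
Variables (T : B) (s : R).
Hypothesis Ts : forall w : R[i], rnorm w <= s -> invertible (1 - w *: T).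

Let P m (w : R[i]) : B := (w *: T) ^+ (2 ^ m).

Let PS m w : P m.+1 w = P m w ^+ 2.
Proof. by rewrite /P expnSr exprM. Qed.

Let minus m : exists2 z : R[i], rnorm z = 1 &
  forall w, 1 + P m w = 1 - P m (z * w).
Proof.
have [z zm z1] := root_minus1 m; exists z => // w.
by rewrite /P !expZn exprMn zm mulN1r scaleNr opprK.
Qed.

Let invP m w : rnorm w <= s -> invertible (1 - P m w).
Proof.
elim: m w => [|m IH] w ws; first by rewrite /P expr1; exact: Ts.
have [z z1 zE] := minus m.
have [Y wY] := IH _ ws.
have [|Z wZ] := IH (z * w); first by rewrite rnormCM z1 mul1r.
rewrite -zE in wZ.
by rewrite PS; eexists; exact: inverse_one_sub_square wY wZ.
Qed.

(** The resolvent identity gives the constant K^2 ||T|| for m = 0. Passing to m + 1 averages the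
    inverses at w and at zeta w, and |zeta| = 1 keeps the constant unchanged. *)
Let lipschitz : exists2 L : R, 0 <= L & forall m (v w : R[i]), rnorm v <= s ->
  rnorm w <= s ->
  opnorm (inv_op (1 - P m v) - inv_op (1 - P m w)) <= L * rnorm (v - w).
Proof.
have [K KP] := resolvent_bounded Ts.
exists (`|K| * opnorm T * `|K|).
  by rewrite !mulr_ge0// opnorm_ge0.
elim=> [|m IH] v w vs ws.
  have iv := inv_opP (invP 0 vs); have iw := inv_opP (invP 0 ws).
  rewrite (inverse_perturbation iw iv).
  have -> : 1 - P 0 w - (1 - P 0 v) = (v - w) *: T.
    by rewrite /P !expr1 opprB addrC addrA subrK scalerBl.
  have K0 (X : B) : opnorm X <= K -> opnorm X <= `|K|.
    by move=> /le_trans; apply; exact: ler_norm.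
  have h1 := K0 _ (KP _ vs); have h2 := K0 _ (KP _ ws).
  rewrite /P !expr1 scale_mulr scale_mull -rnorm_op rnormZ rnorm_op mulrC.
  rewrite ler_wpM2r ?rnorm_ge0// (le_trans (opnormM _ _))//.
  rewrite ler_pM ?opnorm_ge0// (le_trans (opnormM _ _))//.
  by rewrite ler_wpM2r ?opnorm_ge0.
have [z z1 zE] := minus m.
have inv u : rnorm u <= s -> inv_op (1 - P m.+1 u) =
    (2^-1)%:C *: (inv_op (1 - P m u) + inv_op (1 - P m (z * u))).
  move=> us; apply: is_inverse_inv_op; rewrite PS; apply: inverse_one_sub_square.
    exact/inv_opP/invP.
  by rewrite zE; apply/inv_opP/invP; rewrite rnormCM z1 mul1r.
have vz : rnorm (z * v) <= s by rewrite rnormCM z1 mul1r.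
have wz : rnorm (z * w) <= s by rewrite rnormCM z1 mul1r.
rewrite (inv _ vs) (inv _ ws); apply: opnorm_average; first exact: IH.
by apply: le_trans (IH _ _ vz wz) _; rewrite -mulrBr rnormCM z1 mul1r.
Qed.

Let Q (t : R) := forall e : R, 0 < e -> exists M, forall m, (M <= m)%N ->
  opnorm (P m t%:C) < e.

Let opnormP m (t : R) : 0 <= t -> opnorm (P m t%:C) = t ^+ (2 ^ m) * opnorm (T ^+ (2 ^ m)).
Proof.
move=> t0; rewrite /P expZn -rmorphXn -rnorm_op rnormZR rnorm_op ger0_norm//.
exact: exprn_ge0.
Qed.

(** For large m the power at t has norm at most 1/5, and the inverses at t and t + d differ by at
    most L d <= 1/4, so [opnorm_le1_of_inverse] bounds the power at t + d by 1. Retreating to t +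
    d/2 gains the factor ((t + d/2)/(t + d))^(2^m), which tends to 0. *)
Let Q_step (L t d : R) : 0 <= L -> (forall m (v w : R[i]), rnorm v <= s ->
  rnorm w <= s ->
  opnorm (inv_op (1 - P m v) - inv_op (1 - P m w)) <= L * rnorm (v - w)) ->
  0 <= t -> 0 < d -> L * d <= 4^-1 -> t + d <= s -> Q t -> Q (t + d / 2).
Proof.
move=> L0 LP t0 d0 Ld tds Qt.
have ts : rnorm (t%:C : R[i]) <= s by rewrite rnormCR ger0_norm; lra.
have td0 : 0 < t + d by lra.
have tdC : rnorm ((t + d)%:C : R[i]) <= s by rewrite rnormCR ger0_norm; lra.
have [M MP] := Qt 5^-1 ltac:(by rewrite invr_gt0).
have bnd m : (M <= m)%N -> opnorm (P m (t + d)%:C) <= 1.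
  move=> /MP /ltW Pt.
  apply: (opnorm_le1_of_inverse (inv_opP (invP m ts)) (inv_opP (invP m tdC)) Pt).
  apply: le_trans (LP m _ _ tdC ts) _.
  by rewrite -rmorphB /= rnormCR [t + d]addrC addrK ger0_norm ?(ltW d0).
move=> e e0.
pose q := (t + d / 2) / (t + d).
have q0 : 0 <= q by rewrite divr_ge0; lra.
have q1 : q < 1 by rewrite ltr_pdivrMr//; lra.
have [N NP] := expr_lt_eventually q0 q1 e0.
exists (maxn M N) => m; rewrite geq_max => /andP[/bnd Pm Nm].
have -> : opnorm (P m (t + d / 2)%:C) = q ^+ (2 ^ m) * opnorm (P m (t + d)%:C).
  rewrite !opnormP; [|lra|lra]; rewrite mulrA -exprMn divfK//; lra.
apply: le_lt_trans (NP (2 ^ m)%N _); last first.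
  by rewrite (leq_trans Nm)// ltnW// ltn_expl.
by rewrite ler_piMr// exprn_ge0.
Qed.

Let Q_lt t : 0 <= t -> t < s -> Q t.
Proof.
move=> t0 ts; have [L L0 LP] := lipschitz.
pose d := Num.min (s - t) (4 * (L + 1))^-1.
have d0 : 0 < d.
  by rewrite /d lt_min; apply/andP; split; [lra|rewrite invr_gt0; lra].
have ds : d <= s - t by rewrite /d ge_min lexx.
have Ld : L * d <= 4^-1.
  have : d <= (4 * (L + 1))^-1 by rewrite /d ge_min lexx orbT.
  move=> /(ler_wpM2l L0)/le_trans; apply.
  rewrite -(ler_pM2r (_ : 0 < 4 * (L + 1))); last by lra.
  rewrite divfK; lra.
(* A step advances by d/2 but needs a full d inside the disc; the extra d/2 in the hypothesis
   provides it for the step that leads to k. *)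
have Qk (k : nat) : k%:R * (d / 2) + d / 2 <= s -> Q (k%:R * (d / 2)).
  elim: k => [|k IH] ks.
    move=> e e0; exists 0%N => m _.
    by rewrite opnormP mul0r// expr0n expn_eq0/= mul0r.
  rewrite -natr1 mulrDl mul1r in ks *.
  have k0 : 0 <= k%:R * (d / 2) by rewrite mulr_ge0//; lra.
  apply: (Q_step L0 LP) => //; first by lra.
  apply: IH; lra.
(* The grid point k d/2 lies between t and t + d/2, so it is still at least d/2 below s; [Q] then
   descends to t because the norm of the power increases with t. *)
pose k := (Num.truncn (t / (d / 2))).+1.
have d20 : 0 < d / 2 by lra.
have kt : t <= k%:R * (d / 2).
  rewrite -ler_pdivrMr//; apply/ltW/Num.Theory.real_truncnS_gt; exact: num_real.
have kt2 : k%:R * (d / 2) <= t + d / 2.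
  rewrite /k -natr1 mulrDl mul1r lerD2r -ler_pdivlMr// Num.Theory.truncn_le.
  by rewrite divr_ge0// ltW.
have Qkt : Q (k%:R * (d / 2)) by apply: Qk; lra.
move=> e /Qkt[M MP]; exists M => m /MP; apply: le_lt_trans.
have k0 : 0 <= k%:R * (d / 2) by exact: le_trans kt.
rewrite !opnormP// ler_wpM2r ?opnorm_ge0// lerXn2r//.
Qed.

Lemma opnorm_power_lt t : 0 <= t -> t < s ->
  exists2 N, (0 < N)%N & t ^+ N * opnorm (T ^+ N) < 1.
Proof.
move=> t0 ts; have [M /(_ M (leqnn M))] := Q_lt t0 ts ltr01.
by rewrite opnormP// => ?; exists (2 ^ M)%N => //; rewrite expn_gt0.
Qed.

End rickart.

(** With q strictly between r(T) and r, 1 - w T is invertible on the disc |w| <= 1/q, and 1/r is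
    strictly smaller than its radius. *)
Lemma spectral_radius_power T (r : R) : spectral_radius T < r ->
  exists2 N, (0 < N)%N & opnorm (T ^+ N) <= r ^+ N.
Proof.
move=> Tr; have T0 := spectral_radius_ge0 T.
pose q := (spectral_radius T + r) / 2.
have q0 : 0 < q by rewrite /q; lra.
have r0 : 0 < r by lra.
have Ts (w : R[i]) : rnorm w <= q^-1 -> invertible (1 - w *: T).
  have [->|w0] := eqVneq w 0; first by rewrite scale0r subr0 => _; exact: invertible1.
  move=> wq; have wp : 0 < rnorm w.
    by rewrite lt_neqAle rnorm_ge0 andbT eq_sym; apply: contra_neq w0 => /rnorm_eq0.
  have -> : 1 - w *: T = - w *: (T - w^-1 *: (1 : B)).
    by rewrite scalerBr scalerA mulNr divff// scaleN1r opprK scaleNr addrC.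
  apply: invertibleZ; first by rewrite oppr_eq0.
  apply: contrapT => /le_spectral_radius; rewrite rnormCV; apply/negP.
  rewrite -ltNge; apply: (@lt_le_trans _ _ q); first by rewrite /q; lra.
  by rewrite -[q]invrK lef_pV2 ?posrE// invr_gt0.
have [||N N0 NT] := opnorm_power_lt Ts (t := r^-1).
- by rewrite invr_ge0 ltW.
- by rewrite ltf_pV2 ?posrE// /q; lra.
exists N => //; move: NT; rewrite exprVn mulrC ltr_pdivrMr ?exprn_gt0// mul1r.
exact: ltW.
Qed.

End banach.

(** * Self-adjoint operators *)

Section adjoint_theory.
Variables (R : realType) (H : hilbertType R).
Local Notation B := (bounded_op H).
Implicit Types (S T A : B) (x y : H).

(** Riesz for [rdot], one y at a time; the complex identity follows because T commutes with
    multiplication by i. *)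
Lemma adjoint_exists T : exists S : B, forall x y, inner (T x) y = inner x (S y).
Proof.
have /choice[S0 S0E] y : exists z, forall x, rdot (T x) y = rdot x z.
  apply: (riesz_representation (c := opnorm T * rnorm y)).
  - by move=> u v; rewrite linearD rdotDl.
  - by move=> a u; rewrite linearZ rdotZl.
  - move=> x; apply: le_trans (rdot_norm_le _ _) _; rewrite mulrAC.
    by rewrite ler_wpM2r ?rnorm_ge0// opnorm_rnorm.
have SE x y : inner (T x) y = inner x (S0 y).
  by apply: rdot_eq_inner; rewrite ?S0E// -linearZ S0E.
have Slin : linear S0.
  move=> a x y; apply: rdot_eqP => z; rewrite /rdot; congr complex.Re.
  by rewrite -SE !linearDr !linearZr_LR /= -!SE.
have [|S SS] := @linear_op_exists _ _ S0 (opnorm T) Slin.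
  move=> y; have [->|y0] := eqVneq (S0 y) 0.
    by rewrite rnorm0 mulr_ge0 ?opnorm_ge0 ?rnorm_ge0.
  have ny : 0 < rnorm (S0 y).
    by rewrite lt_neqAle rnorm_ge0 andbT eq_sym; apply: contra_neq y0 => /rnorm_eq0.
  (* ||S0 y||^2 equals the real product of T (S0 y) and y; Cauchy-Schwarz, then division by ||S0
     y||. *)
  rewrite -(ler_pM2l ny) -expr2 -rdotxx -S0E (le_trans (rdot_le _ _))//.
  by rewrite mulrA ler_wpM2r ?rnorm_ge0// mulrC opnorm_rnorm.
by exists S => x y; rewrite SS.
Qed.

Lemma inner_adjoint T x y : inner (T x) y = inner x (adjoint T y).
Proof.
have [S SP] := adjoint_exists T.
by rewrite /adjoint; case: xgetP => [_ -> /(_ x y)//|/(_ S)].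
Qed.

Lemma rdot_adjoint T x y : rdot (T x) y = rdot x (adjoint T y).
Proof. by rewrite /rdot inner_adjoint. Qed.

Lemma rdot_adjointr T x y : rdot x (T y) = rdot (adjoint T x) y.
Proof. by rewrite rdotC rdot_adjoint rdotC. Qed.

Lemma adjoint_unique T S :
  (forall x y, rdot (T x) y = rdot x (S y)) -> adjoint T = S.
Proof.
move=> TS; apply: bounded_op_ext => y; apply: rdot_eqP => x.
by rewrite -rdot_adjoint TS.
Qed.

Lemma adjointM S T : adjoint (S * T) = adjoint T * adjoint S.
Proof. by apply: adjoint_unique => x y; rewrite !opE !rdot_adjoint. Qed.

Lemma adjointX T n : adjoint (T ^+ n) = adjoint T ^+ n.
Proof.
elim: n => [|n IH]; first by apply: adjoint_unique.
by rewrite exprS exprSr adjointM IH.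
Qed.

Lemma self_adjointP A : self_adjoint A <-> forall x y, rdot (A x) y = rdot x (A y).
Proof.
by split=> [AE x y|/adjoint_unique//]; rewrite rdot_adjoint AE.
Qed.

Lemma self_adjoint0 : self_adjoint (0 : B).
Proof. by apply/self_adjointP => x y; rewrite !opE rdot0l rdot0r. Qed.

Lemma self_adjointD S T : self_adjoint S -> self_adjoint T -> self_adjoint (S + T).
Proof.
move=> /self_adjointP SS /self_adjointP TT; apply/self_adjointP => x y.
by rewrite !opE rdotDl rdotDr SS TT.
Qed.

Lemma self_adjointZ (a : R) T : self_adjoint T -> self_adjoint (a%:C *: T).
Proof.
move=> /self_adjointP TT; apply/self_adjointP => x y.
by rewrite !opE rdotZl rdotZr TT.
Qed.

Lemma self_adjointX T n : self_adjoint T -> self_adjoint (T ^+ n).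
Proof. by rewrite /self_adjoint adjointX => ->. Qed.

Lemma self_adjoint_sum I (r : seq I) (P : pred I) (F : I -> B) :
  (forall i, P i -> self_adjoint (F i)) -> self_adjoint (\sum_(i <- r | P i) F i).
Proof.
by move=> FP; elim/big_ind : _ => //; [exact: self_adjoint0|exact: self_adjointD].
Qed.

Lemma self_adjoint_poly (p : {poly R}) T : self_adjoint T -> self_adjoint (poly_op p T).
Proof.
by move=> TT; apply: self_adjoint_sum => i _; exact/self_adjointZ/self_adjointX.
Qed.

Lemma self_adjoint_mul_adjoint T : self_adjoint (adjoint T * T).
Proof.
by apply/self_adjointP => x y; rewrite !opE -rdot_adjoint -rdot_adjointr.
Qed.

Lemma rcvg_self_adjoint (u : nat -> B) T : (forall n, self_adjoint (u n)) ->
  rcvg u T -> self_adjoint T.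
Proof.
move=> us uT; apply/self_adjointP => x y.
have c1 := rcvg_rdot (y := y) (rcvg_opE x uT).
have c2 := rcvg_rdot (y := x) (rcvg_opE y uT).
have -> : rdot (T x) y = lim (rdot (u n x) y @[n --> \oo]).
  exact/esym/cvg_lim.
rewrite rdotC; apply: cvg_lim => //.
rewrite (_ : (fun n => rdot (u n x) y) = (fun n => rdot (u n y) x))//.
by apply/funext => n; have /self_adjointP -> := us n; rewrite rdotC.
Qed.

(** For t > 0, ||x - t T x||^2 <= (1 - 2 t c + t^2 M^2) ||x||^2, which is minimal at t = c/M^2 with
    value 1 - c^2/M^2; Neumann's criterion then applies to t T. Taking M = ||T|| + c ensures M > 0
    and c <= M. *)
Lemma lax_milgram T (c : R) : 0 < c ->
  (forall x, c * rnorm x ^+ 2 <= rdot (T x) x) -> invertible T.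
Proof.
move=> c0 Tc; pose M := opnorm T + c; pose t := c / M ^+ 2.
have M0 : 0 < M by rewrite /M ltr_wpDl// opnorm_ge0.
have M20 : 0 < M ^+ 2 by rewrite exprn_gt0.
have t0 : 0 < t by rewrite divr_gt0.
have cM : 0 <= 1 - c ^+ 2 / M ^+ 2.
  rewrite subr_ge0 ler_pdivrMr// mul1r lerXn2r ?nnegrE ?(ltW c0) ?(ltW M0)//.
  by rewrite /M lerDr opnorm_ge0.
suff /(invertibleZ (a := t^-1%:C)) : invertible (t%:C *: T).
  have tt : (t^-1)%:C * t%:C = 1 :> R[i] by rewrite -rmorphM /= mulVf ?gt_eqF.
  rewrite scalerA tt scale1r; apply.
  by rewrite fmorph_eq0 invr_eq0 gt_eqF.
apply: neumann; apply: (@le_lt_trans _ _ (Num.sqrt (1 - c ^+ 2 / M ^+ 2))).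
  apply: opnorm_le_rnorm; first exact: sqrtr_ge0.
  move=> x; rewrite -(@ler_pXn2r _ 2)// ?nnegrE ?mulr_ge0 ?rnorm_ge0 ?sqrtr_ge0//.
  rewrite exprMn sqr_sqrtr// !opE rnormB_sqr rdotZr rnormZR (gtr0_norm t0) exprMn.
  have TM : rnorm (T x) ^+ 2 <= M ^+ 2 * rnorm x ^+ 2.
    rewrite -exprMn lerXn2r// ?nnegrE ?mulr_ge0 ?rnorm_ge0 ?(ltW M0)//.
    rewrite (le_trans (opnorm_rnorm _ _))// ler_wpM2r ?rnorm_ge0//.
    by rewrite lerDl ltW.
  have h1 : t ^+ 2 * rnorm (T x) ^+ 2 <= t ^+ 2 * (M ^+ 2 * rnorm x ^+ 2).
    by rewrite ler_wpM2l// exprn_ge0// ltW.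
  have h2 : t * (c * rnorm x ^+ 2) <= t * rdot x (T x).
    by rewrite ler_wpM2l ?(ltW t0)// rdotC.
  have e1 : t ^+ 2 * (M ^+ 2 * rnorm x ^+ 2) = c ^+ 2 / M ^+ 2 * rnorm x ^+ 2.
    by rewrite /t; field; rewrite gt_eqF.
  have e2 : t * (c * rnorm x ^+ 2) = c ^+ 2 / M ^+ 2 * rnorm x ^+ 2.
    by rewrite /t; field; rewrite gt_eqF.
  rewrite e1 in h1; rewrite e2 in h2; rewrite mulrBl mul1r.
  move: h1 h2; move: (t ^+ 2 * _) (t * _) (c ^+ 2 / _ * _) => a b d; lra.
rewrite -[ltRHS]sqrtr1 ltr_sqrt//.
have : 0 < c ^+ 2 / M ^+ 2 by rewrite divr_gt0// exprn_gt0.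
lra.
Qed.

Lemma rdot_i_self_adjoint T x : self_adjoint T -> rdot ('i *: T x) x = 0.
Proof.
move=> /self_adjointP TT.
have : rdot ('i *: T x) x = - rdot ('i *: T x) x.
  by rewrite -{1}linearZ TT rdotC -rdot_ii scalerA -expr2 sqrCi scaleN1r rdotNr.
lra.
Qed.

(** Let b = Im z be nonzero. As <T x, x> is real, the real part of <i b (T - z) x, x> is b^2
    ||x||^2, so i b (T - z) is coercive. *)
Lemma self_adjoint_spectrum_real T z : self_adjoint T -> spectrum T z ->
  z = (complex.Re z)%:C.
Proof.
move=> TT Tz; have [z0|z0] := eqVneq (complex.Im z) 0.
  by rewrite [LHS]complexE z0 mulr0 addr0.
exfalso; apply: Tz; pose b := complex.Im z.
have b0 : b%:C * 'i != 0 :> R[i].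
  by rewrite mulf_neq0 ?neq0Ci// fmorph_eq0.
suff /(invertibleZ (a := (b%:C * 'i)^-1)) : invertible ((b%:C * 'i) *: (T - z *: (1 : B))).
  by rewrite scalerA mulVf// scale1r; apply; rewrite invr_eq0.
apply: (lax_milgram (c := b ^+ 2)) => [|x]; first by rewrite exprn_even_gt0.
rewrite !opE -scalerA rdotZl scalerBr rdotBl rdot_i_self_adjoint// sub0r.
have -> : rdot ('i *: (z *: x)) x = - b * rnorm x ^+ 2.
  rewrite rdot_ri /= linearZl_LR /= inner_norm -rnormE -rmorphXn /= {1}[z]complexE.
  rewrite /b; move: (complex.Re z) (complex.Im z) (rnorm x ^+ 2) => u v w.
  by rewrite /=; ring.
by rewrite (_ : b * _ = b ^+ 2 * rnorm x ^+ 2)//; ring.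
Qed.

Lemma nonneg_self_adjoint_spectrum T (t : R) : (forall x, 0 <= rdot (T x) x) ->
  spectrum T t%:C -> 0 <= t.
Proof.
move=> T0 Tt; rewrite leNgt; apply/negP => t0; apply: Tt.
apply: (lax_milgram (c := - t)) => [|x]; first by rewrite oppr_gt0.
rewrite !opE rdotBl rdotZl rdotxx mulNr addrC lerDl; exact: T0.
Qed.

Lemma adjoint_mul_ge0 T x : 0 <= rdot ((adjoint T * T) x) x.
Proof. by rewrite !opE rdotC -rdot_adjoint rdotxx sqr_ge0. Qed.

End adjoint_theory.

(** * Polynomials of an operator and spectral mapping *)

Section polynomials.
Variables (R : realType) (H : normedModType R[i]).
Local Notation B := (bounded_op H).
Implicit Types (T : B) (p q : {poly R[i]}).

(** Complex coefficients, in contrast to [poly_op], so that the polynomial splits into linear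
    factors. *)
Definition cpoly_op p T : B := \sum_(i < size p) p`_i *: T ^+ i.

Lemma cpoly_opE n p T : (size p <= n)%N ->
  cpoly_op p T = \sum_(i < n) p`_i *: T ^+ i.
Proof.
move=> pn; rewrite /cpoly_op (big_ord_widen n (fun i => p`_i *: T ^+ i))//.
rewrite big_mkcond/=; apply: eq_bigr => i _; case: ltnP => // pi.
by rewrite nth_default// scale0r.
Qed.

Lemma cpoly_opD p q T : cpoly_op (p + q) T = cpoly_op p T + cpoly_op q T.
Proof.
pose n := maxn (size p) (size q).
rewrite !(@cpoly_opE n) ?leq_maxl ?leq_maxr ?(leq_trans (size_polyD _ _))//.
by rewrite -big_split/=; apply: eq_bigr => i _; rewrite coefD scalerDl.
Qed.

Lemma cpoly_opZ a p T : cpoly_op (a *: p) T = a *: cpoly_op p T.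
Proof.
rewrite (@cpoly_opE (size p)) ?size_scale_leq// scaler_sumr.
by apply: eq_bigr => i _; rewrite coefZ scalerA.
Qed.

Lemma cpoly_opC a T : cpoly_op a%:P T = a *: (1 : B).
Proof.
by rewrite (@cpoly_opE 1) ?size_polyC_leq1// big_ord1 expr0 coefC.
Qed.

Lemma cpoly_opMX p T : cpoly_op (p * 'X) T = cpoly_op p T * T.
Proof.
rewrite (@cpoly_opE (size p).+1); last first.
  by rewrite (leq_trans (size_polyMleq _ _))// size_polyX addn2.
rewrite big_ord_recl coefMX eqxx scale0r add0r mulr_suml.
by apply: eq_bigr => i _; rewrite coefMX/= scale_mull -exprSr.
Qed.

Lemma cpoly_opX T : cpoly_op 'X T = T.
Proof. by rewrite -['X]mul1r cpoly_opMX cpoly_opC scale1r mul1r. Qed.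

Lemma cpoly_opM p q T : cpoly_op (p * q) T = cpoly_op p T * cpoly_op q T.
Proof.
elim/poly_ind: q => [|q c IH].
  by rewrite mulr0 -[0]polyC0 cpoly_opC scale0r mulr0.
rewrite mulrDr mulrA [p * c%:P]mulrC mul_polyC !cpoly_opD !cpoly_opMX IH.
by rewrite cpoly_opZ cpoly_opC mulrDr scale_mulr mulr1 mulrA.
Qed.

(** Split p - z into linear factors: if T - w were invertible for every root w, so would be p(T) -
    z. The first alternative is the case p - z = 0, whose leading coefficient vanishes. *)
Lemma cpoly_op_spectrum p T (z : R[i]) : spectrum (cpoly_op p T) z ->
  p = z%:P \/ exists2 w, spectrum T w & p.[w] = z.
Proof.
move=> pTz; have [/eqP|pz] := eqVneq (p - z%:P) 0.
  by rewrite subr_eq0 => /eqP; left.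
right; have [r rE] := closed_field_poly_normal (p - z%:P).
have opE : cpoly_op p T - z *: (1 : B) =
    lead_coef (p - z%:P) *: \prod_(w <- r) (T - w *: (1 : B)).
  have <- : cpoly_op (p - z%:P) T = cpoly_op p T - z *: (1 : B).
    by rewrite cpoly_opD -polyCN cpoly_opC scaleNr.
  rewrite {1}rE cpoly_opZ; congr (_ *: _); elim: r {rE} => [|w r IH].
    by rewrite !big_nil -[1]polyC1 cpoly_opC scale1r.
  by rewrite !big_cons cpoly_opM IH cpoly_opD -polyCN cpoly_opC cpoly_opX scaleNr.
have [rT|] := pselect (forall w, w \in r -> invertible (T - w *: (1 : B))).
  exfalso; apply: pTz; rewrite opE; apply: invertibleZ; first by rewrite lead_coef_eq0.
  rewrite big_seq; elim/big_ind : _ => //; first exact: invertible1.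
  exact: invertibleM.
move=> /existsNP[w /not_implyP[wr Tw]]; exists w => //.
have : (p - z%:P).[w] = 0.
  rewrite rE hornerZ; suff -> : (\prod_(x <- r) ('X - x%:P)).[w] = 0 by rewrite mulr0.
  by apply/rootP; rewrite root_prod_XsubC.
by rewrite hornerD hornerN hornerC => /eqP; rewrite subr_eq0 => /eqP.
Qed.

Lemma poly_op_cpoly (p : {poly R}) T :
  poly_op p T = cpoly_op (map_poly (real_complex R) p) T.
Proof.
rewrite /poly_op (@cpoly_opE (size p)) ?size_map_poly//.
by apply: eq_bigr => i _; rewrite coef_map.
Qed.

Lemma poly_opD (p q : {poly R}) T : poly_op (p + q) T = poly_op p T + poly_op q T.
Proof. by rewrite !poly_op_cpoly rmorphD /= cpoly_opD. Qed.

Lemma poly_opM (p q : {poly R}) T : poly_op (p * q) T = poly_op p T * poly_op q T.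
Proof. by rewrite !poly_op_cpoly rmorphM /= cpoly_opM. Qed.

Lemma poly_opC (a : R) T : poly_op a%:P T = a%:C *: (1 : B).
Proof. by rewrite poly_op_cpoly map_polyC cpoly_opC. Qed.

Lemma poly_opX T : poly_op 'X T = T.
Proof. by rewrite poly_op_cpoly map_polyX cpoly_opX. Qed.

Lemma poly_op_spectrum (p : {poly R}) T (z : R[i]) : spectrum (poly_op p T) z ->
  (exists2 c : R, p = c%:P & z = c%:C) \/
  exists2 w, spectrum T w & (map_poly (real_complex R) p).[w] = z.
Proof.
rewrite poly_op_cpoly => /cpoly_op_spectrum[pz|]; last by right.
left; have p1 : (size p <= 1)%N.
  by rewrite -(size_map_poly (real_complex R)) pz size_polyC_leq1.
exists p`_0; first exact: size1_polyC.
by move: pz; rewrite [p in map_poly _ p]size1_polyC// map_polyC => /polyC_inj.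
Qed.

End polynomials.

(** * Norm and spectrum of a self-adjoint operator *)

Section self_adjoint_norm.
Variables (R : realType) (H : hilbertType R).
Hypothesis H_neq0 : exists x : H, x != 0.
Local Notation B := (bounded_op H).
Implicit Types (S T A : B) (x y : H).

(** Otherwise W = T^2 - N^2 is invertible. Expanding gives ||W x||^2 <= N^2 (N^2 ||x||^2 - ||T
    x||^2), and the bounded inverse of W turns this into ||T x||^2 <= (N^2 - 1/C) ||x||^2, against
    the definition of N as the norm. *)
Lemma self_adjoint_norm_spectrum T : self_adjoint T ->
  exists2 t : R, spectrum T t%:C & `|t| = opnorm T.
Proof.
move=> /self_adjointP TT; set N := opnorm T; have N0 : 0 <= N by exact: opnorm_ge0.
have [|nP] := pselect (spectrum T N%:C); first by exists N => //; rewrite ger0_norm.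
have [|nN] := pselect (spectrum T (- N)%:C).
  by exists (- N) => //; rewrite normrN ger0_norm.
move: nP nN => /contrapT iP /contrapT iN; exfalso.
have [V [_ VW]] := invertibleM iP iN.
pose W : B := (T - N%:C *: (1 : B)) * (T - (- N)%:C *: (1 : B)).
have WE x : W x = T (T x) - (N ^+ 2)%:C *: x.
  rewrite /W !opE linearB linearZ /= rmorphN !scaleNr !opprK scalerDr scalerA.
  by rewrite -rmorphM -expr2 opprD addrA addrK.
pose C := opnorm V ^+ 2 * N ^+ 2 + 1.
have C0 : 0 < C by rewrite ltr_wpDl// mulr_ge0// sqr_ge0.
have le1 x : rnorm (T x) ^+ 2 <= N ^+ 2 * rnorm x ^+ 2.
  rewrite -exprMn lerXn2r// ?nnegrE ?mulr_ge0 ?rnorm_ge0//.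
  exact: opnorm_rnorm.
have Wle x : rnorm (W x) ^+ 2 <= N ^+ 2 * (N ^+ 2 * rnorm x ^+ 2 - rnorm (T x) ^+ 2).
  rewrite WE rnormB_sqr rdotZr TT rdotxx rnormZR exprMn.
  have := le1 (T x); rewrite -normrX ger0_norm ?sqr_ge0//.
  move: (rnorm (T (T x))) (rnorm (T x)) (rnorm x) => a b c; lra.
have xle x : rnorm x ^+ 2 <= C * (N ^+ 2 * rnorm x ^+ 2 - rnorm (T x) ^+ 2).
  have xV : rnorm x <= opnorm V * rnorm (W x).
    have {1}-> : x = V (W x) by rewrite -opE_mul [V * W]VW.
    exact: opnorm_rnorm.
  have : rnorm x ^+ 2 <= (opnorm V * rnorm (W x)) ^+ 2.
    by rewrite lerXn2r// ?nnegrE ?mulr_ge0 ?rnorm_ge0 ?opnorm_ge0.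
  rewrite exprMn => /le_trans; apply.
  have /(ler_wpM2l (sqr_ge0 (opnorm V)))/le_trans := Wle x; apply.
  have ge0 : 0 <= N ^+ 2 * rnorm x ^+ 2 - rnorm (T x) ^+ 2.
    by rewrite subr_ge0.
  by rewrite /C [leRHS]mulrDl mul1r mulrA lerDl.
have Cle x : rnorm (T x) ^+ 2 <= (N ^+ 2 - C^-1) * rnorm x ^+ 2.
  have := xle x; rewrite mulrC -ler_pdivrMr// mulrBl; lra.
(* A nonzero vector enters here: it makes the new bound nonnegative, so that its square root is
   meaningful. *)
have NC : 0 <= N ^+ 2 - C^-1.
  have [x x0] := H_neq0; rewrite -(@pmulr_lge0 _ (rnorm x ^+ 2)).
    by apply: le_trans (Cle x); exact: sqr_ge0.
  rewrite exprn_even_gt0//=; apply: contra_neq x0 => ?; exact: rnorm_eq0.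
have : N <= Num.sqrt (N ^+ 2 - C^-1).
  apply: opnorm_le_rnorm => [|x]; first exact: sqrtr_ge0.
  rewrite -(@ler_pXn2r _ 2)// ?nnegrE ?mulr_ge0 ?rnorm_ge0 ?sqrtr_ge0//.
  by rewrite exprMn sqr_sqrtr.
rewrite -(@ler_pXn2r _ 2)// ?nnegrE ?sqrtr_ge0// sqr_sqrtr//.
have : 0 < C^-1 by rewrite invr_gt0.
lra.
Qed.

Lemma opnorm_poly_op_le T (p : {poly R}) (c : R) : self_adjoint T ->
  (forall t : R, spectrum T t%:C -> `|p.[t]| <= c) -> opnorm (poly_op p T) <= c.
Proof.
move=> TT pc.
have [t pt <-] := self_adjoint_norm_spectrum (self_adjoint_poly p TT).
have [[a pa [->]]|[w Tw wt]] := poly_op_spectrum pt.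
  (* For constant p the hypothesis speaks only about points of the spectrum, so one must exist. *)
  have [s Ts _] := self_adjoint_norm_spectrum TT.
  by have := pc _ Ts; rewrite pa hornerC.
have wE := self_adjoint_spectrum_real TT Tw.
have := pc (complex.Re w); rewrite -wE => /(_ Tw).
by move: wt; rewrite wE horner_map => -[<-].
Qed.

End self_adjoint_norm.

(** * Continuous functional calculus *)

Section functional_calculus.
Variables (R : realType) (H : hilbertType R).
Hypothesis H_neq0 : exists x : H, x != 0.
Local Notation B := (bounded_op H).
Implicit Types (S T A Q : B) (x y : H) (f g : R -> R) (p q : {poly R}).

(** One polynomial per tolerance replaces the sequence and the filter of uniform convergence; the
    converse rebuilds a sequence from the tolerances 1/(n+1). *)
Lemma is_cfcP f T Q : is_cfc f T Q <-> forall e : R, 0 < e ->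
  exists2 p, (forall t : R, spectrum T t%:C -> `|p.[t] - f t| <= e) &
             opnorm (poly_op p T - Q) <= e.
Proof.
split=> [[p [pf /rcvgP pQ]] e e0|h].
  have [N pN] := pQ _ e0.
  have : \forall n \near \oo, forall t, spectrum T t%:C -> `|(p n).[t] - f t| < e.
    have /(_ [set g | forall t, spectrum T t%:C -> `|g t - f t| < e]) := pf.
    apply; rewrite uniform_nbhs; exists [set xy | `|xy.1 - xy.2| < e]; split.
      by exists e.
    by move=> g /= gf t /gf /=; rewrite distrC.
  move=> [M _ pM]; exists (p (maxn N M)).
    by move=> t /(pM _ (leq_maxr N M)) /ltW.
  by rewrite -rnorm_op ltW// pN// leq_maxl.
have /choice[p pP] (n : nat) : exists p : {poly R},
    (forall t : R, spectrum T t%:C -> `|p.[t] - f t| <= n.+1%:R^-1) /\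
    opnorm (poly_op p T - Q) <= n.+1%:R^-1.
  have n0 : 0 < n.+1%:R^-1 :> R by rewrite invr_gt0 ltr0n.
  by have [p p1 p2] := h _ n0; exists p.
have invn (e : R) : 0 < e -> exists N, forall n, (N <= n)%N -> n.+1%:R^-1 < e.
  move=> e0; have /cvgrPdist_lt/(_ _ e0)[N _ NP] := @cvg_harmonic R.
  have i0 n : 0 <= n.+1%:R^-1 :> R by rewrite invr_ge0 ler0n.
  by exists N => n /NP; rewrite /harmonic /= sub0r normrN ger0_norm.
exists p; split.
  move=> U; rewrite uniform_nbhs => -[E [[e /= e0 eE] EU]].
  have [N NP] := invn _ e0; exists N => // n /NP Nn; apply: EU => t /= Tt.
  apply: eE; rewrite /= distrC.
  by rewrite (le_lt_trans ((pP n).1 _ Tt)).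
apply/rcvgP => e /invn[N NP]; exists N => n /NP; apply: le_lt_trans.
exact: (pP n).2.
Qed.

Lemma poly_bounded_spectrum T p : exists c : R, forall t : R,
  spectrum T t%:C -> `|p.[t]| <= c.
Proof.
exists (\sum_(i < size p) `|p`_i| * opnorm T ^+ i) => t /spectrum_le_opnorm.
rewrite rnormCR => tT; rewrite horner_coef (le_trans (ler_norm_sum _ _ _))//.
apply: ler_sum => i _; rewrite normrM normrX ler_wpM2l//.
by rewrite lerXn2r// ?nnegrE ?opnorm_ge0.
Qed.

Lemma cfc_bounded f T Q : is_cfc f T Q ->
  exists c : R, forall t : R, spectrum T t%:C -> `|f t| <= c.
Proof.
move=> /is_cfcP/(_ _ ltr01)[p pf _]; have [c pc] := poly_bounded_spectrum T p.
exists (c + 1) => t Tt; have := pc _ Tt; have := pf _ Tt.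
have := ler_normB p.[t] (p.[t] - f t); rewrite opprB addrC subrK; lra.
Qed.

Lemma cfc_eq f g T Q : (forall t : R, spectrum T t%:C -> f t = g t) ->
  is_cfc f T Q -> is_cfc g T Q.
Proof.
move=> fg /is_cfcP fQ; apply/is_cfcP => e /fQ[p pf pQ]; exists p => // t Tt.
by rewrite -fg ?pf.
Qed.

Lemma cfc_poly p T : is_cfc (horner p) T (poly_op p T).
Proof.
by apply/is_cfcP => e e0; exists p => [t _|]; rewrite subrr ?normr0 -?rnorm_op ?rnorm0 ltW.
Qed.

Lemma cfc_id T : is_cfc id T T.
Proof.
rewrite -{2}(poly_opX T); apply: cfc_eq (cfc_poly 'X T) => t _.
by rewrite hornerX.
Qed.

Lemma cfc_cst (a : R) T : is_cfc (fun=> a) T (a%:C *: (1 : B)).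
Proof.
rewrite -(poly_opC a T); apply: cfc_eq (cfc_poly a%:P T) => t _.
by rewrite hornerC.
Qed.

Lemma cfc0 T : is_cfc (fun=> 0) T 0.
Proof. by rewrite -(scale0r (1 : B)); exact: cfc_cst. Qed.

Lemma cfc1 T : is_cfc (fun=> 1) T 1.
Proof. by rewrite -[X in is_cfc _ _ X]scale1r; exact: (cfc_cst 1). Qed.

Lemma cfc_limit f T Q :
  (forall e : R, 0 < e -> exists g S, [/\ is_cfc g T S,
     forall t : R, spectrum T t%:C -> `|g t - f t| <= e & opnorm (S - Q) <= e]) ->
  is_cfc f T Q.
Proof.
move=> h; apply/is_cfcP => e e0; have e20 : 0 < e / 2 by lra.
have [g [S [/is_cfcP/(_ _ e20)[p pg pS] gf SQ]]] := h _ e20.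
exists p => [t Tt|].
  by rewrite (splitr e) (le_trans (ler_distD (g t) _ _))// lerD ?pg ?gf.
by rewrite (splitr e) (le_trans (opnorm_dist _ S _))// lerD.
Qed.

Lemma cfcD f g T S Q : is_cfc f T S -> is_cfc g T Q ->
  is_cfc (fun t => f t + g t) T (S + Q).
Proof.
move=> /is_cfcP fS /is_cfcP gQ; apply/is_cfcP => e e0.
have e20 : 0 < e / 2 by lra.
have [p pf pS] := fS _ e20; have [q qg qQ] := gQ _ e20.
exists (p + q) => [t Tt|].
  by rewrite hornerD opprD addrACA (splitr e) (le_trans (ler_normD _ _))// lerD ?pf ?qg.
by rewrite poly_opD opprD addrACA (splitr e) (le_trans (opnorm_leD _ _))// lerD.
Qed.

Lemma cfcM f g T S Q : is_cfc f T S -> is_cfc g T Q ->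
  is_cfc (fun t => f t * g t) T (S * Q).
Proof.
move=> fS gQ; have [c fc] := cfc_bounded fS; have [d gd] := cfc_bounded gQ.
move: fS gQ => /is_cfcP fS /is_cfcP gQ; apply/is_cfcP => e e0.
pose K := `|c| + `|d| + opnorm S + opnorm Q + 1.
have K1 : 1 <= K.
  by rewrite /K lerDr !addr_ge0// opnorm_ge0.
pose r := Num.min 1 (e / K).
have r0 : 0 < r by rewrite lt_min ltr01 divr_gt0//; lra.
have r1 : r <= 1 by rewrite ge_min lexx.
have rK : r * K <= e.
  have K0 : 0 < K by lra.
  by rewrite -ler_pdivlMr// ge_min lexx orbT.
have [p pf pS] := fS _ r0; have [q qg qQ] := gQ _ r0.
(* One estimate for scalars and operators alike: errors a, b <= r <= 1 on factors of size a', b'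
   produce at most r (1 + b') + a' r <= r K <= e. *)
have prod (a b a' b' : R) : 0 <= a -> 0 <= b -> a <= r -> b <= r ->
    0 <= a' -> 0 <= b' -> a' + b' + 1 <= K -> a * (b + b') + a' * b <= e.
  move=> a0 b0 ar br a'0 b'0 abK; apply: le_trans rK.
  have h1 : a * (b + b') <= r * (1 + b') by apply: ler_pM; lra.
  have h2 : a' * b <= a' * r by rewrite ler_wpM2l.
  have h3 : r * (a' + b' + 1) <= r * K by rewrite ler_wpM2l// ltW.
  lra.
exists (p * q) => [t Tt|].
  have -> : (p * q).[t] - f t * g t =
      (p.[t] - f t) * (q.[t] - g t + g t) + f t * (q.[t] - g t).
    by rewrite hornerM; ring.
  rewrite (le_trans (ler_normD _ _))// !normrM.
  apply: le_trans (prod `|p.[t] - f t| `|q.[t] - g t| `|f t| `|g t| _ _ _ _ _ _ _) => //.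
  - by rewrite lerD2r ler_wpM2l// ler_normD.
  - exact: pf.
  - exact: qg.
  - have := fc _ Tt; have := gd _ Tt; have := ler_norm c; have := ler_norm d.
    by rewrite /K; have := opnorm_ge0 S; have := opnorm_ge0 Q; lra.
have -> : poly_op (p * q) T - S * Q =
   (poly_op p T - S) * (poly_op q T - Q + Q) + S * (poly_op q T - Q).
  by rewrite poly_opM subrK mulrBl mulrBr addrA subrK.
rewrite (le_trans (opnorm_leD _ _))//.
apply: le_trans (prod _ (opnorm (poly_op q T - Q)) (opnorm S) (opnorm Q)
   (opnorm_ge0 (poly_op p T - S)) _ pS qQ _ _ _); rewrite ?opnorm_ge0//.
  rewrite lerD ?opnormM// (le_trans (opnormM _ _))// ler_wpM2l ?opnorm_ge0//.
  exact: opnorm_leD.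
by rewrite /K; have := normr_ge0 c; have := normr_ge0 d;
  move: (opnorm S) (opnorm Q) => a b; lra.
Qed.

Lemma cfcZ (a : R) f T Q : is_cfc f T Q -> is_cfc (fun t => a * f t) T (a%:C *: Q).
Proof.
move=> /(cfcM (cfc_cst a T)); rewrite scale_mull mul1r; exact.
Qed.

Lemma cfcN f T Q : is_cfc f T Q -> is_cfc (fun t => - f t) T (- Q).
Proof.
move=> /(cfcZ (-1)); rewrite rmorphN1 scaleN1r; apply: cfc_eq => t _.
by rewrite mulN1r.
Qed.

Lemma cfcX f T Q n : is_cfc f T Q -> is_cfc (fun t => f t ^+ n) T (Q ^+ n).
Proof.
move=> fQ; elim: n => [|n IH].
  by rewrite expr0; exact: cfc1.
by rewrite exprS; apply: cfc_eq (cfcM fQ IH) => t _; rewrite exprS.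
Qed.

Section self_adjoint.
Variable T : B.
Hypothesis TT : self_adjoint T.

(** The bound on polynomials passes to their limits. Uniqueness of the calculus and its continuity
    under uniform convergence both come from this. *)
Lemma cfc_dist f g S Q (c : R) : is_cfc f T S -> is_cfc g T Q ->
  (forall t : R, spectrum T t%:C -> `|f t - g t| <= c) -> opnorm (S - Q) <= c.
Proof.
move=> fS gQ fgc; have : is_cfc (fun t => f t - g t) T (S - Q).
  exact: cfcD fS (cfcN gQ).
move=> /is_cfcP h; apply/ler_addgt0Pl => e e0.
have e20 : 0 < e / 2 by lra.
have [p pfg pSQ] := h _ e20.
have : opnorm (poly_op p T) <= e / 2 + c.
  apply: opnorm_poly_op_le => // t Tt.
  rewrite -(subrK (f t - g t) p.[t]) (le_trans (ler_normD _ _))// lerD//.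
    exact: pfg.
  exact: fgc.
have := opnorm_leD (S - Q - poly_op p T) (poly_op p T).
rewrite subrK (opnormB (S - Q)); move: pSQ.
move: (opnorm (S - Q)) (opnorm _) (opnorm _) => u v w; lra.
Qed.

Lemma cfc_opnorm_le f Q (c : R) : is_cfc f T Q ->
  (forall t : R, spectrum T t%:C -> `|f t| <= c) -> opnorm Q <= c.
Proof.
move=> fQ fc; rewrite -[Q]subr0 -(scale0r (1 : B)).
by apply: (cfc_dist fQ (cfc_cst 0 T)) => t Tt; rewrite subr0 fc.
Qed.

Lemma cfc_unique f g S Q : is_cfc f T S -> is_cfc g T Q ->
  (forall t : R, spectrum T t%:C -> f t = g t) -> S = Q.
Proof.
move=> fS gQ fg; apply/eqP; rewrite -subr_eq0; apply/eqP/rnorm_eq0/eqP.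
rewrite eq_le rnorm_ge0 andbT rnorm_op.
by apply: (cfc_dist fS gQ) => t Tt; rewrite fg// subrr normr0.
Qed.

Lemma cfc_self_adjoint f Q : is_cfc f T Q -> self_adjoint Q.
Proof.
by move=> [p [_ /rcvgP]]; apply: rcvg_self_adjoint => n; exact: self_adjoint_poly.
Qed.

Lemma cfc_cvg f (g : nat -> R -> R) (S : nat -> B) :
  (forall n, is_cfc (g n) T (S n)) ->
  (forall e : R, 0 < e -> exists N, forall n, (N <= n)%N -> forall t : R,
     spectrum T t%:C -> `|g n t - f t| <= e) ->
  exists2 Q, is_cfc f T Q & rcvg S Q.
Proof.
move=> gS gf; have [Q SQ] : exists Q, rcvg S Q.
  apply: rcauchy_op => e e0; have e40 : 0 < e / 4 by lra.
  have [N gN] := gf _ e40; exists N => m n Nm Nn.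
  apply: (@le_lt_trans _ _ (e / 2)); last by lra.
  apply: cfc_dist (gS m) (gS n) _ => t Tt.
  apply: le_trans (ler_distD (f t) _ _) _.
  have := gN _ Nm _ Tt; have := gN _ Nn _ Tt.
  by rewrite (distrC (f t)); lra.
exists Q => //; apply: cfc_limit => e e0.
have [N gN] := gf _ e0; have [M SM] := SQ _ e0.
exists (g (maxn N M)), (S (maxn N M)); split => //.
  by move=> t; apply: gN; exact: leq_maxl.
by rewrite -rnorm_op; apply/ltW/SM; exact: leq_maxr.
Qed.

Lemma cfc_exists f :
  (forall e : R, 0 < e -> exists p, forall t : R, spectrum T t%:C ->
     `|p.[t] - f t| <= e) -> exists Q, is_cfc f T Q.
Proof.
move=> fp; have /choice[p pP] (n : nat) : exists p, forall t : R,
    spectrum T t%:C -> `|p.[t] - f t| <= n.+1%:R^-1.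
  by apply: fp; rewrite invr_gt0 ltr0n.
have [||Q fQ _] := @cfc_cvg f (fun n => horner (p n)) (fun n => poly_op (p n) T).
- by move=> n; exact: cfc_poly.
- move=> e e0; have /cvgrPdist_lt/(_ _ e0)[N _ NP] := @cvg_harmonic R.
  exists N => n /NP + t Tt; rewrite /harmonic /= sub0r normrN.
  rewrite ger0_norm ?invr_ge0 ?ler0n// => /ltW; apply: le_trans; exact: pP.
- by exists Q.
Qed.

(** The tail at x is dominated term by term by the tail at c, so the exponential series converges
    uniformly on [-c, c]. *)
Lemma exp_coeff_tail (x c : R) n : `|x| <= c ->
  `|series (exp_coeff x) n - expR x| <= expR c - series (exp_coeff c) n.
Proof.
move=> xc.
have tail m : (n <= m)%N -> `|series (exp_coeff x) n - series (exp_coeff x) m| <=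
    series (exp_coeff c) m - series (exp_coeff c) n.
  move=> nm; rewrite distrC !sub_series_geq// (le_trans (ler_norm_sum _ _ _))//.
  apply: ler_sum => i _; rewrite /exp_coeff /= normrM normrX normfV.
  rewrite [in leLHS](ger0_norm (ler0n _ _)) ler_wpM2r ?invr_ge0 ?ler0n//.
  by rewrite lerXn2r// nnegrE// (le_trans _ xc).
have cx : series (exp_coeff x) @ \oo --> expR x by exact: is_cvg_series_exp_coeff.
have cc : series (exp_coeff c) @ \oo --> expR c by exact: is_cvg_series_exp_coeff.
have c1 : `|series (exp_coeff x) n - series (exp_coeff x) m| @[m --> \oo] -->
    `|series (exp_coeff x) n - expR x|.
  by apply: cvg_norm; apply: cvgB => //; exact: cvg_cst.
have c2 : series (exp_coeff c) m - series (exp_coeff c) n @[m --> \oo] -->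
    expR c - series (exp_coeff c) n.
  by apply: cvgB => //; exact: cvg_cst.
rewrite -(cvg_lim _ c1)// -(cvg_lim _ c2)//; apply: ler_lim.
- by apply/cvg_ex; eexists; exact: c1.
- by apply/cvg_ex; eexists; exact: c2.
- by exists n => // m; exact: tail.
Qed.

(** The exponential of A = f(T) is computed inside the calculus of T, where it can be multiplied
    with other functions of T; this is how e^A with A = ln(1 + K)/2 squares to 1 + K. *)
Lemma cfc_exp f A : is_cfc f T A -> is_cfc (fun t => expR (f t)) T (exp_op A).
Proof.
move=> fA; have [c fc] := cfc_bounded fA.
have [||Q fQ SQ] := @cfc_cvg (fun t => expR (f t))
    (fun n t => series (exp_coeff (f t)) n)
    (series (fun k => (k`!%:R : R[i])^-1 *: A ^+ k)).
- elim=> [|n IH].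
    rewrite /series /= big_geq//.
    by apply: cfc_eq (cfc0 T) => t _; rewrite big_geq.
  rewrite seriesSr.
  have cfcn : is_cfc (fun t => (n`!%:R)^-1 * f t ^+ n) T ((n`!%:R)^-1 *: A ^+ n).
    have -> : (n`!%:R)^-1 = ((n`!%:R)^-1 : R)%:C :> R[i].
      by rewrite fmorphV /= rmorph_nat.
    exact: cfcZ (cfcX n fA).
  apply: cfc_eq (cfcD IH cfcn) => t _; rewrite seriesSr; congr (_ + _).
  by rewrite /exp_coeff /= mulrC.
- move=> e e0.
  have /cvgrPdist_lt/(_ _ e0)[N _ NP] : series (exp_coeff c) @ \oo --> expR c.
    exact: is_cvg_series_exp_coeff.
  exists N => n /NP /= /ltW cn t /fc /(exp_coeff_tail n) /le_trans; apply.
  by apply: le_trans cn; exact: ler_norm.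
- suff -> : exp_op A = Q by [].
  by move: SQ => /rcvgP SQ; apply: cvg_lim.
Qed.

End self_adjoint.

Lemma exp_op_inverse A : self_adjoint A -> is_inverse (exp_op A) (exp_op (- A)).
Proof.
move=> AA; have e1 := cfc_exp AA (cfc_id A).
have e2 := cfc_exp AA (cfcN (cfc_id A)).
split.
  apply: (cfc_unique AA (cfcM e1 e2) (cfc1 A)) => t _ /=.
  by rewrite -expRD subrr expR0.
apply: (cfc_unique AA (cfcM e2 e1) (cfc1 A)) => t _ /=.
by rewrite -expRD addNr expR0.
Qed.

End functional_calculus.

(** * Polynomial approximation *)

Section bernstein.
Variable R : realType.
Implicit Types (f g h : nat -> R) (x c : R).

(* Bernstein polynomials in de Casteljau form: the value at [x] is the
   expectation of [g K] for [K] binomially distributed with parameters [n], [x]. *)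
Fixpoint bernstein n g : {poly R} :=
  if n is m.+1 then
    'X * bernstein m (fun k => g k.+1) + (1 - 'X) * bernstein m g
  else (g 0%N)%:P.

Let hornerS n g x : (bernstein n.+1 g).[x] =
  x * (bernstein n (fun k => g k.+1)).[x] + (1 - x) * (bernstein n g).[x].
Proof. by rewrite /= !hornerE. Qed.

Lemma bernstein_cst n c x : (bernstein n (fun=> c)).[x] = c.
Proof. by elim: n => [|n IH]; rewrite ?hornerC// hornerS IH; ring. Qed.

Lemma bernstein_lin n c g h x : (bernstein n (fun k => c * g k + h k)).[x] =
  c * (bernstein n g).[x] + (bernstein n h).[x].
Proof.
by elim: n g h => [|n IH] g h; rewrite ?hornerC// !hornerS !IH; ring.
Qed.

Lemma le_bernstein n g h x : 0 <= x -> x <= 1 ->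
  (forall k, (k <= n)%N -> g k <= h k) -> (bernstein n g).[x] <= (bernstein n h).[x].
Proof.
move=> x0 x1; elim: n g h => [|n IH] g h gh; first by rewrite !hornerC gh.
rewrite !hornerS lerD// ler_wpM2l ?subr_ge0//; apply: IH => k kn; apply: gh => //.
exact: leqW.
Qed.

(** Second moment about c of a binomial variable: variance plus squared bias. An arbitrary c is
    needed because the recursion shifts it by 1. *)
Lemma bernstein_sqr n c x : (bernstein n (fun k => (k%:R - c) ^+ 2)).[x] =
  n%:R * (x * (1 - x)) + (n%:R * x - c) ^+ 2.
Proof.
elim: n c => [|n IH] c; first by rewrite hornerC; ring.
rewrite hornerS IH -natr1.
rewrite (_ : (fun k => (k.+1%:R - c) ^+ 2) = (fun k : nat => (k%:R - (c - 1)) ^+ 2)).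
  by rewrite IH; ring.
by apply/funext => k; rewrite -natr1; congr (_ ^+ 2); ring.
Qed.

(** The hypothesis is uniform continuity in a form that can be averaged at once: the quadratic term
    integrates to C times the binomial variance. *)
Lemma bernstein_approximation (f : R -> R) (M : R) : 0 < M ->
  (forall e : R, 0 < e -> exists2 C : R, 0 <= C & forall s t : R,
     0 <= s <= M -> 0 <= t <= M -> `|f s - f t| <= e + C * (s - t) ^+ 2) ->
  forall e : R, 0 < e -> exists p : {poly R}, forall t : R, 0 <= t <= M ->
     `|p.[t] - f t| <= e.
Proof.
move=> M0 fM e e0; have e20 : 0 < e / 2 by lra.
have [C C0 fC] := fM _ e20.
(* After scaling [0, M] to [0, 1] the quadratic term contributes C M^2 x (1 - x)/n, so C M^2/n <=
   e/2 is enough. *)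
pose n := (Num.truncn (C * M ^+ 2 / (e / 2))).+1.
have n0 : 0 < n%:R :> R by rewrite ltr0n.
have CMn : C * M ^+ 2 / n%:R <= e / 2.
  rewrite ler_pdivrMr// (mulrC (e / 2)) -ler_pdivrMr//.
  by apply/ltW/Num.Theory.real_truncnS_gt; exact: num_real.
pose g k := f (k%:R * M / n%:R).
exists (bernstein n g \Po (M^-1 *: 'X)) => t /andP[t0 tM].
rewrite horner_comp hornerZ hornerX; set x := M^-1 * t.
have x0 : 0 <= x by rewrite mulr_ge0// invr_ge0 ltW.
have x1 : x <= 1 by rewrite /x mulrC ler_pdivrMr// mul1r.
have tE : t = M * x by rewrite /x mulrA divff ?mul1r// gt_eqF.
pose c := C * M ^+ 2 / n%:R ^+ 2.
have gk k : (k <= n)%N -> `|g k - f t| <= e / 2 + c * (k%:R - n%:R * x) ^+ 2.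
  move=> kn; apply: le_trans (fC _ _ _ _) _; last 1 first.
  - rewrite lerD2l tE /c; set y := (X in X <= _).
    suff -> : y = C * M ^+ 2 / n%:R ^+ 2 * (k%:R - n%:R * x) ^+ 2 by [].
    by rewrite /y; field; rewrite gt_eqF.
  - rewrite divr_ge0 ?mulr_ge0 ?ler0n ?(ltW M0)//=.
    by rewrite ler_pdivrMr// mulrC ler_pM2l// ler_nat.
  - by rewrite t0 tM.
have var : c * (bernstein n (fun k => (k%:R - n%:R * x) ^+ 2)).[x] <= e / 2.
  apply: le_trans CMn; rewrite bernstein_sqr subrr expr0n addr0.
  have -> : c * (n%:R * (x * (1 - x))) = C * M ^+ 2 / n%:R * (x * (1 - x)).
    by rewrite /c; field; rewrite gt_eqF.
  rewrite ler_piMr//.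
    by rewrite divr_ge0 ?(ltW n0)// mulr_ge0// sqr_ge0.
  by rewrite mulr_ile1 ?subr_ge0//; lra.
have ub : (bernstein n g).[x] <= (bernstein n
    (fun k => c * (k%:R - n%:R * x) ^+ 2 + (f t + e / 2))).[x].
  by apply: le_bernstein => // k /gk; rewrite ler_norml => /andP[_]; lra.
have lb : (bernstein n (fun k => - c * (k%:R - n%:R * x) ^+ 2 + (f t - e / 2))).[x]
    <= (bernstein n g).[x].
  by apply: le_bernstein => // k /gk; rewrite ler_norml => /andP[+ _]; lra.
move: ub lb; rewrite !bernstein_lin !bernstein_cst ler_norml.
by move=> ub lb; apply/andP; split; lra.
Qed.

(** Dividing by t^l reduces to two numbers of [0, 1] with sum 1, and a <= a^l on [0, 1]. *)
Lemma powR_subadditive (s t l : R) : 0 <= s -> s <= t -> 0 <= l -> l <= 1 ->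
  t `^ l - s `^ l <= (t - s) `^ l.
Proof.
move=> s0 st l0 l1; have [t0|t0] := leP t 0.
  have -> : t = 0 by lra.
  have -> : s = 0 by lra.
  by rewrite subrr subrr powR_ge0.
have le1 (a : R) : 0 <= a -> a <= 1 -> a <= a `^ l.
  move=> a0 a1; have [->|an] := eqVneq a 0; first exact: powR_ge0.
  by rewrite -{1}(powRr1 a0) ger_powR// lt_neqAle eq_sym an a0 a1.
have h1 : s / t <= (s / t) `^ l.
  by apply: le1; rewrite ?divr_ge0 ?(ltW t0)// ler_pdivrMr// mul1r.
have h2 : (t - s) / t <= ((t - s) / t) `^ l.
  apply: le1; first by rewrite divr_ge0 ?(ltW t0)// subr_ge0.
  by rewrite ler_pdivrMr// mul1r; lra.
have tl : 0 < t `^ l by rewrite powR_gt0.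
have e1 : s `^ l = t `^ l * (s / t) `^ l.
  by rewrite -powRM ?divr_ge0 ?(ltW t0)// mulrC divfK// gt_eqF.
have e2 : (t - s) `^ l = t `^ l * ((t - s) / t) `^ l.
  by rewrite -powRM ?divr_ge0 ?(ltW t0) ?subr_ge0// mulrC divfK// gt_eqF.
rewrite e1 e2 lerBlDr -mulrDr ler_peMr ?(ltW tl)//.
have : (t - s) / t + s / t = 1 by rewrite -mulrDl subrK divff// gt_eqF.
lra.
Qed.

Lemma powR_approximation (l M : R) : 0 <= l -> l <= 1 -> 0 < M ->
  forall e : R, 0 < e -> exists p : {poly R}, forall t : R, 0 <= t <= M ->
     `|p.[t] - t `^ l| <= e.
Proof.
move=> l0 l1 M0; have [->|ln0] := eqVneq l 0.
  by move=> e e0; exists 1 => t _; rewrite hornerC powRr0 subrr normr0 ltW.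
have lp : 0 < l by rewrite lt_neqAle eq_sym ln0.
apply: bernstein_approximation => // e e0.
(* The threshold with d^l = e: below it (t - s)^l <= e, above it (t - s)^2/d^2 >= 1 and M^l (t -
   s)^2/d^2 dominates. *)
pose d := e `^ l^-1; have d0 : 0 < d by exact: powR_gt0.
have C0 : 0 <= M `^ l / d ^+ 2 by rewrite divr_ge0 ?powR_ge0// exprn_ge0 ?ltW.
exists (M `^ l / d ^+ 2) => // s t.
wlog st : s t / s <= t => [wl /andP[s0 sM] /andP[t0 tM]|].
  have [st|/ltW ts] := leP s t; first by apply: wl => //; rewrite ?s0 ?t0.
  by rewrite distrC -[(s - t) ^+ 2]sqrrN opprB; apply: wl => //; rewrite ?s0 ?t0.
move=> /andP[s0 sM] /andP[t0 tM].
rewrite distrC ger0_norm; last by rewrite subr_ge0 ge0_ler_powR.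
apply: le_trans (powR_subadditive s0 st l0 l1) _.
rewrite -[(s - t) ^+ 2]sqrrN opprB.
have ts0 : 0 <= t - s by lra.
have [tsd|dts] := leP (t - s) d.
  have : (t - s) `^ l <= d `^ l by rewrite ge0_ler_powR// nnegrE ?ltW.
  rewrite /d -powRrM mulVf// powRr1 ?(ltW e0)// => /le_trans; apply.
  by rewrite lerDl mulr_ge0// sqr_ge0.
have : (t - s) `^ l <= M `^ l by rewrite ge0_ler_powR// ?nnegrE ?(ltW M0)//; lra.
move=> /le_trans; apply.
apply: (@le_trans _ _ (M `^ l / d ^+ 2 * (t - s) ^+ 2)); last by rewrite lerDr ltW.
rewrite -mulrA ler_peMr ?powR_ge0// mulrC ler_pdivlMr ?exprn_gt0// mul1r.
by rewrite lerXn2r ?nnegrE ?(ltW d0)// ltW.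
Qed.

Lemma ln_approximation (M : R) : 0 < M ->
  forall e : R, 0 < e -> exists p : {poly R}, forall t : R, 0 <= t <= M ->
     `|p.[t] - ln (1 + t)| <= e.
Proof.
move=> M0; apply: bernstein_approximation => // e e0.
(* ln(1 + t) is 1-Lipschitz on t >= 0, and u <= e + u^2/(4 e) because u^2 - 4 e u + 4 e^2 is a
   square. *)
exists (4 * e)^-1; first by rewrite invr_ge0; lra.
move=> s t; wlog st : s t / s <= t => [wl s0M t0M|].
  have [st|/ltW ts] := leP s t; first exact: wl.
  by rewrite distrC -[(s - t) ^+ 2]sqrrN opprB; apply: wl.
move=> /andP[s0 sM] /andP[t0 tM].
have s1 : 0 < 1 + s by lra.
have t1 : 0 < 1 + t by lra.
rewrite distrC ger0_norm; last by rewrite subr_ge0 ler_ln ?posrE//; lra.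
have : ln (1 + t) - ln (1 + s) <= t - s.
  rewrite -ln_div ?posrE//.
  have -> : (1 + t) / (1 + s) = 1 + (t - s) / (1 + s) by field; lra.
  have q0 : 0 <= (t - s) / (1 + s) by rewrite divr_ge0; lra.
  apply: le_trans (le_ln1Dx _) _; first by lra.
  by rewrite ler_pdivrMr// ler_peMr; lra.
move=> /le_trans; apply.
rewrite -subr_ge0.
have -> : e + (4 * e)^-1 * (s - t) ^+ 2 - (t - s) =
   (4 * e)^-1 * (2 * e - (t - s)) ^+ 2 by field; lra.
by rewrite mulr_ge0 ?sqr_ge0// invr_ge0; lra.
Qed.

End bernstein.

(** * Polar decomposition and Aluthge transforms *)

Section aluthge_theory.
Variables (R : realType) (H : hilbertType R).
Hypothesis H_neq0 : exists x : H, x != 0.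
Local Notation B := (bounded_op H).
Implicit Types (S T A K P Q U X : B) (x y : H).

Definition positive_op P := self_adjoint P /\ forall x, 0 <= rdot (P x) x.

Lemma positive_spectrum P (t : R) : positive_op P -> spectrum P t%:C ->
  0 <= t <= opnorm P.
Proof.
move=> [_ P0] Pt; have t0 := nonneg_self_adjoint_spectrum P0 Pt.
by rewrite t0/= -[leLHS]ger0_norm// -rnormCR; exact: spectrum_le_opnorm.
Qed.

Lemma positive_cfc_exists P (f : R -> R) : positive_op P ->
  (forall M : R, 0 < M -> forall e : R, 0 < e -> exists p : {poly R},
     forall t : R, 0 <= t <= M -> `|p.[t] - f t| <= e) ->
  exists Q, is_cfc f P Q.
Proof.
move=> Pp fM; apply: cfc_exists => //; first exact: Pp.1.
have M0 : 0 < opnorm P + 1 by rewrite ltr_wpDl// opnorm_ge0.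
move=> e /(fM _ M0)[p pf]; exists p => t /(positive_spectrum Pp)/andP[t0 tP].
by apply: pf; rewrite t0 (le_trans tP)// lerDl.
Qed.

Lemma pow_op_cfc P (l : R) : positive_op P -> 0 <= l -> l <= 1 ->
  is_cfc (fun t => t `^ l) P (pow_op P l).
Proof.
move=> Pp l0 l1; have [Q PQ] : exists Q, is_cfc (fun t => t `^ l) P Q.
  by apply: positive_cfc_exists => // M M0; exact: powR_approximation.
by rewrite /pow_op /cfc; case: xgetP => [_ -> //|/(_ Q)].
Qed.

Lemma pow_opM P (a b : R) : positive_op P -> 0 <= a -> 0 <= b -> a + b <= 1 ->
  a + b != 0 -> pow_op P a * pow_op P b = pow_op P (a + b).
Proof.
move=> Pp a0 b0 ab1 ab0.
have ca : is_cfc (fun t => t `^ a) P (pow_op P a) by apply: pow_op_cfc => //; lra.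
have cb : is_cfc (fun t => t `^ b) P (pow_op P b) by apply: pow_op_cfc => //; lra.
apply: (cfc_unique H_neq0 Pp.1 (cfcM ca cb)).
  by apply: (pow_op_cfc (l := a + b)) => //; lra.
by move=> t _ /=; rewrite powRD// (negbTE ab0).
Qed.

Lemma pow_op1 P : positive_op P -> pow_op P 1 = P.
Proof.
move=> Pp; apply: (cfc_unique H_neq0 Pp.1 (pow_op_cfc Pp ler01 (lexx 1)) (cfc_id P)).
by move=> t /(positive_spectrum Pp)/andP[t0 _]; rewrite powRr1.
Qed.

(** P^l is the square of the self-adjoint P^(l/2). *)
Lemma positive_pow_op P (l : R) : positive_op P -> 0 < l -> l <= 1 ->
  positive_op (pow_op P l).
Proof.
move=> Pp l0 l1; split; first by apply: cfc_self_adjoint Pp.1 _ _ (pow_op_cfc Pp _ _); lra.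
have l20 : 0 <= l / 2 by lra.
have Ql : self_adjoint (pow_op P (l / 2)).
  by apply: cfc_self_adjoint Pp.1 _ _ (pow_op_cfc Pp _ _); lra.
move=> x; rewrite (splitr l) -pow_opM//; [|lra|lra].
by rewrite opE (self_adjointP _).1// rdotxx sqr_ge0.
Qed.

Lemma opnorm_pow_op_le P (l : R) : positive_op P -> 0 <= l -> l <= 1 ->
  opnorm (pow_op P l) <= opnorm P `^ l.
Proof.
move=> Pp l0 l1; apply: (cfc_opnorm_le H_neq0 Pp.1 (pow_op_cfc Pp l0 l1)).
move=> t /(positive_spectrum Pp)/andP[t0 tP].
by rewrite ger0_norm ?powR_ge0// ge0_ler_powR// nnegrE opnorm_ge0.
Qed.

Lemma positive_adjoint_mul T : positive_op (adjoint T * T).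
Proof.
by split; [exact: self_adjoint_mul_adjoint|exact: adjoint_mul_ge0].
Qed.

Lemma positive_abs_op T : positive_op (abs_op T).
Proof. by apply: positive_pow_op; [exact: positive_adjoint_mul|lra|lra]. Qed.

Lemma abs_opM T : abs_op T * abs_op T = adjoint T * T.
Proof.
have TT := positive_adjoint_mul T.
have h : 2^-1 + 2^-1 = 1 :> R by field.
by rewrite /abs_op pow_opM// h ?pow_op1// ?oner_eq0// invr_ge0.
Qed.

Lemma rdot_abs_op T x y : rdot (abs_op T x) (abs_op T y) = rdot (T x) (T y).
Proof.
rewrite -(self_adjointP _).1; last exact: (positive_abs_op T).1.
by rewrite -opE_mul abs_opM opE -rdot_adjointr.
Qed.

Lemma rnorm_abs_op T x : rnorm (abs_op T x) = rnorm (T x).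
Proof.
apply/eqP; rewrite -(@eqrXn2 _ 2) ?rnorm_ge0//.
by rewrite -!rdotxx rdot_abs_op.
Qed.

Lemma opnorm_abs_op T : opnorm (abs_op T) = opnorm T.
Proof.
apply/eqP; rewrite eq_le; apply/andP; split.
  apply: opnorm_le_rnorm => [|x]; first exact: opnorm_ge0.
  by rewrite rnorm_abs_op; exact: opnorm_rnorm.
apply: opnorm_le_rnorm => [|x]; first exact: opnorm_ge0.
by rewrite -rnorm_abs_op; exact: opnorm_rnorm.
Qed.

Lemma positive_abs_kernel T w :
  (forall y, rdot w (abs_op T y) = 0) -> abs_op T w = 0.
Proof.
move=> h; apply: rdot_eqP => y; rewrite rdot0r rdotC.
by rewrite (self_adjointP _).1//; exact: (positive_abs_op T).1.
Qed.

Lemma closed_subspace_linear_eq (S T : B) : closed_subspace [set x | S x = T x].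
Proof.
split => /= [|a x y Sx Sy|u l Su ul]; first by rewrite !linear0.
  by rewrite !bounded_op_linear Sx Sy.
apply: (rcvg_unique (rcvg_op S ul)).
by apply: rcvg_eq (rcvg_op T ul) => n; rewrite Su.
Qed.

(* [U] is the strong limit of [T (|T| + 1/(n+1))^-1]. *)
Lemma polar_contraction_exists T : exists U : B,
  [/\ forall x, rnorm (U x) <= rnorm x, U * abs_op T = T &
      forall x, abs_op T x = 0 -> U x = 0].
Proof.
pose Q := abs_op T; have [QQ Q0] := positive_abs_op T.
have QT x : rnorm (T x) = rnorm (Q x) by rewrite rnorm_abs_op.
pose e (n : nat) : R := n.+1%:R^-1.
have e0 n : 0 < e n by rewrite invr_gt0 ltr0n.
pose Qe n : B := Q + (e n)%:C *: (1 : B).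
have QeE n x : Qe n x = Q x + (e n)%:C *: x by rewrite /Qe !opE.
have Qe_inv n : invertible (Qe n).
  apply: (lax_milgram (c := e n)) => // x.
  by rewrite QeE rdotDl rdotZl rdotxx lerDr; exact: Q0.
have /choice[Z ZP] n : exists Z, is_inverse (Qe n) Z by exact: Qe_inv.
pose V n : B := T * Z n.
have VE n x : V n x = T (Z n x) by [].
have QZ n x : Qe n (Z n x) = x by have [h _] := ZP n; rewrite -opE_mul h.
have ZQ n x : Z n (Qe n x) = x by have [_ h] := ZP n; rewrite -opE_mul h.
(* With y = Z n x: ||V n x|| = ||T y|| = || |T| y ||, and adding a positive multiple of y to |T| y
   only increases the norm because |T| >= 0. *)
have Vle n x : rnorm (V n x) <= rnorm x.
  rewrite -{2}(QZ n x) VE QT QeE; set y := Z n x.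
  rewrite -(@ler_pXn2r _ 2)// ?nnegrE ?rnorm_ge0// rnormD_sqr rdotZr.
  rewrite -addrA lerDl addr_ge0 ?sqr_ge0//.
  by rewrite mulr_ge0// mulr_ge0 ?(ltW (e0 n))//; exact: Q0.
have VQ n y : V n (Q y) - T y = - (e n)%:C *: V n y.
  have -> : Q y = Qe n y - (e n)%:C *: y by rewrite QeE addrK.
  by rewrite op_sub op_scale VE ZQ addrAC subrr add0r scaleNr.
have VQ_cvg y : rcvg (fun n => V n (Q y)) (T y).
  move=> d d0; have y0 : 0 < rnorm y + 1 by rewrite ltr_wpDl// rnorm_ge0.
  have /cvgrPdist_lt/(_ _ (divr_gt0 d0 y0))[N _ NP] := @cvg_harmonic R.
  exists N => n /NP; rewrite /harmonic /= sub0r normrN -/(e n) gtr0_norm//.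
  rewrite ltr_pdivlMr// VQ scaleNr rnormN rnormZR gtr0_norm//.
  apply: le_lt_trans; rewrite ler_pM2l//.
  by rewrite (le_trans (Vle _ _))// lerDl.
have V0 y : Q y = 0 -> forall n, V n y = 0.
  move=> Qy n; apply: rnorm_eq0; rewrite VE.
  have -> : y = Qe n ((e n)^-1%:C *: y).
    rewrite QeE op_scale Qy scaler0 add0r scalerA -rmorphM /= divff ?gt_eqF//.
    by rewrite scale1r.
  by rewrite ZQ op_scale rnormZR QT Qy rnorm0 mulr0.
(* The vectors where V n x is Cauchy form a closed subspace containing the range of |T|; what is
   orthogonal to it lies in the kernel of |T|, where V n vanishes. *)
have Vc : closed_subspace [set x | rcauchy (fun n => V n x)].
  split => [|a x y Vx Vy|u l Vu ul] d d0.
  - by exists 0%N => m n _ _; rewrite !op_zero subrr rnorm0.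
  - have a0 : 0 < `|a| + 1 by rewrite ltr_wpDl.
    have d20 : 0 < d / 2 by lra.
    have [N1 h1] := Vx _ (divr_gt0 d20 a0); have [N2 h2] := Vy _ d20.
    exists (maxn N1 N2) => m n; rewrite !geq_max => /andP[m1 m2] /andP[n1 n2].
    rewrite !bounded_op_linear opprD addrACA -scalerBr.
    rewrite (le_lt_trans (ler_rnormD _ _))// (splitr d) ler_ltD ?h2//.
    have := h1 _ _ m1 n1; rewrite ltr_pdivlMr// => /ltW/(le_trans _); apply.
    by rewrite rnormZR mulrC ler_wpM2l ?rnorm_ge0// lerDl.
  - have d40 : 0 < d / 4 by lra.
    have [K /(_ K (leqnn K)) uK] := ul _ d40; have [N hN] := Vu K _ d40.
    exists N => m n Nm Nn.
    have -> : V m l - V n l = V m (l - u K) + (V m (u K) - V n (u K)) + V n (u K - l).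
      by rewrite !op_sub !addrA !subrK.
    have := ler_rnormD (V m (l - u K) + (V m (u K) - V n (u K))) (V n (u K - l)).
    have := ler_rnormD (V m (l - u K)) (V m (u K) - V n (u K)).
    have := Vle m (l - u K); have := Vle n (u K - l); have := hN _ _ Nm Nn.
    by move: uK; rewrite (rnormB l); lra.
have Vall x : rcauchy (fun n => V n x).
  have [v [w [Vv wV ->]]] := projection_theorem x Vc.
  rewrite -(scale1r v); apply: (subspaceP Vc 1) => //.
  have Qw : Q w = 0.
    apply: positive_abs_kernel => y; apply: wV; exact: rcvg_cauchy (VQ_cvg y).
  by move=> d d0; exists 0%N => m n _ _; rewrite !V0// subrr rnorm0.
have [|U UP] := @rcauchy_strong _ _ V 1 _ Vall.
  by move=> n; apply: opnorm_le_rnorm => [|x]; rewrite ?mul1r ?ler01//; exact: Vle.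
exists U; split.
- by move=> x; apply: rcvg_le (UP x) _ => n; exact: Vle.
- by apply: bounded_op_ext => y; exact: rcvg_unique (UP (Q y)) (VQ_cvg y).
- move=> x Qx; apply: (rcvg_unique (UP x)).
  by apply: rcvg_eq (rcvg_cst 0) => n; rewrite V0.
Qed.

(** ||U* U x - x||^2 = ||U* U x||^2 - 2 ||U x||^2 + ||x||^2 <= 0, since U* is a contraction too. *)
Lemma contraction_adjointK U x : (forall x, rnorm (U x) <= rnorm x) ->
  rnorm (U x) = rnorm x -> adjoint U (U x) = x.
Proof.
move=> Ule Ux; apply/eqP; rewrite -subr_eq0; apply/eqP/rnorm_eq0/eqP.
rewrite -sqrf_eq0 eq_le sqr_ge0 andbT rnormB_sqr -rdot_adjointr rdotxx Ux.
have U'le y : rnorm (adjoint U y) <= rnorm y.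
  have [->|y0] := eqVneq (adjoint U y) 0; first by rewrite rnorm0 rnorm_ge0.
  have ny : 0 < rnorm (adjoint U y).
    by rewrite lt_neqAle rnorm_ge0 andbT eq_sym; apply: contra_neq y0 => /rnorm_eq0.
  rewrite -(ler_pM2l ny) -expr2 -rdotxx -rdot_adjoint.
  by rewrite (le_trans (rdot_le _ _))// ler_wpM2r ?rnorm_ge0.
have : rnorm (adjoint U (U x)) ^+ 2 <= rnorm x ^+ 2.
  by rewrite lerXn2r// ?nnegrE ?rnorm_ge0// -Ux.
lra.
Qed.

Lemma polar_factor_exists T : exists U : B,
  [/\ partial_isometry U, forall x, U x = 0 <-> T x = 0 & T = U * abs_op T].
Proof.
have [U [Ule UQ UK]] := polar_contraction_exists T.
(* Vectors whose norm U preserves, described as fixed points of U* U so that they visibly form a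
   closed subspace. It contains the range of |T|, so its complement lies in the kernel. *)
pose W := [set x | adjoint U (U x) = x].
have Wc : closed_subspace W by exact: (closed_subspace_linear_eq (adjoint U * U) 1).
have split_ker x : exists w w', [/\ adjoint U (U w) = w, abs_op T w' = 0,
    rdot w' w = 0 & x = w + w'].
  have [w [w' [Ww w'W ->]]] := projection_theorem x Wc.
  exists w, w'; split => //; last exact: w'W.
  apply: positive_abs_kernel => y; apply: w'W.
  apply: contraction_adjointK => //.
  by rewrite -opE_mul UQ rnorm_abs_op.
exists U; split; last exact/esym.
- move=> x xU; have [w [w' [Uw Qw' ww' xE]]] := split_ker x.
  have w'0 : w' = 0.
    apply: rnorm_eq0; apply/eqP; rewrite -sqrf_eq0 -rdotxx.
    have : rdot x w' = 0 by rewrite /rdot xU// UK.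
    by rewrite xE rdotDl (rdotC w) ww' add0r => ->.
  rewrite xE w'0 addr0 -!rnormE; congr (_%:C); apply/eqP.
  by rewrite -(@eqrXn2 _ 2) ?rnorm_ge0// -!rdotxx rdot_adjointr Uw.
- move=> x; split => [Ux|Tx].
    have [w [w' [Uw Qw' _ xE]]] := split_ker x.
    have w0 : w = 0.
      by move: Ux; rewrite xE op_add (UK w')// addr0 => Uw0; rewrite -Uw Uw0 linear0.
    by apply: rnorm_eq0; rewrite -rnorm_abs_op xE w0 add0r Qw' rnorm0.
  by apply: UK; apply: rnorm_eq0; rewrite rnorm_abs_op Tx rnorm0.
Qed.

Lemma polar_factorP T : [/\ partial_isometry (polar_factor T),
  forall x, polar_factor T x = 0 <-> T x = 0 & T = polar_factor T * abs_op T].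
Proof.
have [U UP] := polar_factor_exists T.
by rewrite /polar_factor; case: xgetP => [_ -> //|/(_ U)].
Qed.

Lemma opnorm_partial_isometry U : partial_isometry U -> opnorm U <= 1.
Proof.
move=> Uiso; apply: opnorm_le_rnorm => // x; rewrite mul1r.
have Uc : closed_subspace [set y | U y = 0] by exact: (closed_subspace_linear_eq U 0).
have [v [w [/= Uv wU ->]]] := projection_theorem x Uc.
have Uw : rnorm (U w) = rnorm w.
  (* [partial_isometry] asks for orthogonality in [inner]; the kernel of U is stable under
     multiplication by i. *)
  rewrite /rnorm (Uiso w)// => y Uy; apply: (orthogonal_inner _ wU) => //= z Uz.
  by rewrite op_scale Uz scaler0.
rewrite op_add Uv add0r Uw -(@ler_pXn2r _ 2)// ?nnegrE ?rnorm_ge0//.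
by rewrite rnormD_sqr rdotC (wU v)// mulr0 addr0 lerDr sqr_ge0.
Qed.

(** * Norm and spectral radius under the Aluthge transform *)

Section aluthge_lambda.
Variable l : R.
Hypotheses (l0 : 0 <= l) (l1 : l <= 1).

Lemma opnorm_aluthge_le T : opnorm (aluthge l T) <= opnorm T.
Proof.
have [Uiso _ _] := polar_factorP T; have Q0 := positive_abs_op T.
have l'0 : 0 <= 1 - l by rewrite subr_ge0.
have l'1 : 1 - l <= 1 by rewrite gerBl.
have lE : l + (1 - l) = 1 by rewrite addrC subrK.
have -> : opnorm T = opnorm T `^ l * opnorm T `^ (1 - l).
  by rewrite -powRD lE ?powRr1 ?opnorm_ge0// oner_eq0.
rewrite /aluthge (le_trans (opnormM _ _))// ler_pM ?opnorm_ge0//; last first.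
  by rewrite -[in leRHS]opnorm_abs_op opnorm_pow_op_le.
rewrite (le_trans (opnormM _ _))// -[leRHS]mulr1 ler_pM ?opnorm_ge0//.
  by rewrite -[in leRHS]opnorm_abs_op opnorm_pow_op_le.
exact: opnorm_partial_isometry.
Qed.

Lemma spectral_radius_aluthge T : spectral_radius (aluthge l T) = spectral_radius T.
Proof.
have [_ _ TE] := polar_factorP T; have Q0 := positive_abs_op T.
have lE : 1 - l + l = 1 by rewrite subrK.
rewrite /aluthge -mulrA spectral_radiusC -mulrA pow_opM// ?lE ?oner_eq0// ?subr_ge0//.
by rewrite pow_op1// -TE.
Qed.

Lemma opnorm_iter_aluthge_le n T : opnorm (iter n (aluthge l) T) <= opnorm T.
Proof.
by elim: n => // n IH; rewrite iterS (le_trans (opnorm_aluthge_le _)).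
Qed.

Lemma spectral_radius_iter_aluthge n T :
  spectral_radius (iter n (aluthge l) T) = spectral_radius T.
Proof. by elim: n => // n IH; rewrite iterS spectral_radius_aluthge. Qed.

End aluthge_lambda.

(* In the notation of the header [P = 1 + K]; the calculus is applied to [K],
   because [ln (1 + t)] is continuous on the whole half-line [t >= 0]. *)
Lemma exp_similarity_opnorm_le T (r : R) : spectral_radius T < r ->
  exists2 A, self_adjoint A & opnorm (exp_op A * T * exp_op (- A)) <= r.
Proof.
move=> Tr; have r0 : 0 < r by exact: le_lt_trans (spectral_radius_ge0 T) Tr.
have [[//|m] _ TN] := spectral_radius_power Tr.
pose a k : R := r ^- (2 * k).
have a0 k : 0 <= a k by rewrite invr_ge0 exprn_ge0// ltW.
have aS k : a k = r ^+ 2 * a k.+1.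
  by rewrite /a mulnS exprD invfM mulrA divff ?mul1r// expf_neq0// gt_eqF.
(* With N = m + 1, these are the terms k = 1, ..., N - 1 of P; the term k = 0 is the identity. *)
pose K : B := \sum_(i < m) (a i.+1)%:C *: (adjoint (T ^+ i.+1) * T ^+ i.+1).
have KE x y : rdot (K x) y = \sum_(i < m) a i.+1 * rdot ((T ^+ i.+1) x) ((T ^+ i.+1) y).
  rewrite /K opE_sum; elim/big_ind2 : _ => [|u1 u2 v1 v2 <- <-|i _].
  - exact: rdot0l.
  - exact: rdotDl.
  - by rewrite !opE rdotZl -rdot_adjointr.
have Kp : positive_op K.
  split; last by move=> x; rewrite KE sumr_ge0// => i _; rewrite rdotxx mulr_ge0 ?sqr_ge0.
  by apply: self_adjoint_sum => i _; exact/self_adjointZ/self_adjoint_mul_adjoint.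
have Kcfc : exists A, is_cfc (fun t => ln (1 + t)) K A.
  by apply: positive_cfc_exists => // M M0; exact: ln_approximation.
have [A0 cA0] := Kcfc; have cA := cfcZ 2^-1 cA0; set A := _ *: A0 in cA.
have cX := cfc_exp H_neq0 Kp.1 cA.
have AA : self_adjoint A := cfc_self_adjoint Kp.1 cA.
have XX : self_adjoint (exp_op A) := cfc_self_adjoint Kp.1 cX.
have X2 : exp_op A * exp_op A = 1 + K.
  apply: (cfc_unique H_neq0 Kp.1 (cfcM cX cX) (cfcD (cfc1 K) (cfc_id K))) => t.
  move=> /(positive_spectrum Kp)/andP[t0 _].
  rewrite -expRD (_ : _ + _ = ln (1 + t)); last by field.
  by rewrite lnK// posrE; lra.
pose G x := \sum_(k < m.+1) a k * rnorm ((T ^+ k) x) ^+ 2.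
have XG x : rnorm (exp_op A x) ^+ 2 = G x.
  rewrite -rdotxx -(self_adjointP _).1// -opE_mul X2 !opE rdotDl rdotxx KE.
  rewrite /G big_ord_recl /a muln0 expr0 invr1 mul1r; congr (_ + _).
  by apply: eq_bigr => i _; rewrite rdotxx.
(* All terms of G (T x) but the last are r^2 times the next term of G x, by [aS]. The last one,
   r^(-2m) ||T^(m+1) x||^2, is at most r^2 ||x||^2 by [TN], which is r^2 times the term k = 0. *)
have GT x : G (T x) <= r ^+ 2 * G x.
  have TS k : (T ^+ k) (T x) = (T ^+ k.+1) x by rewrite -opE_mul -exprSr.
  rewrite /G big_ord_recr [in leRHS]big_ord_recl mulrDr addrC; apply: lerD.
    rewrite mulr_sumr; apply: ler_sum => i _.
    by rewrite TS /= [a i]aS mulrA.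
  rewrite TS /= /a muln0 expr0 invr1 mul1r ler_pdivrMl ?exprn_gt0//.
  have := opnorm_rnorm (T ^+ m.+1) x => /le_trans/(_ (ler_wpM2r (rnorm_ge0 x) TN)).
  move=> h; apply: le_trans (_ : (r ^+ m.+1 * rnorm x) ^+ 2 <= _).
    by rewrite lerXn2r// nnegrE ?mulr_ge0 ?exprn_ge0 ?rnorm_ge0 ?(ltW r0).
  by rewrite exprMn -exprM mulnC mulnS addnC exprD -mulrA.
exists A => //; apply: opnorm_le_rnorm; first exact: ltW.
(* With y = e^(-A) x: ||e^A T y||^2 = G (T y) <= r^2 G y = r^2 ||e^A y||^2 = r^2 ||x||^2. *)
move=> x; have [EF _] := exp_op_inverse H_neq0 AA.
rewrite -(@ler_pXn2r _ 2)// ?nnegrE ?mulr_ge0 ?rnorm_ge0 ?(ltW r0)//.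
rewrite !opE XG (le_trans (GT _))// -XG exprMn.
by rewrite -opE_mul EF.
Qed.

End aluthge_theory.

(** * The two infima *)

(** The approximants also show that S is nonempty, and r bounds it below, so [inf] is not a default
    value. *)
Lemma inf_eqP (R : realType) (S : set R) (r : R) : (forall s, S s -> r <= s) ->
  (forall e : R, 0 < e -> exists2 s, S s & s <= r + e) -> inf S = r.
Proof.
move=> rS Sr; have [s0 Ss0 _] := Sr _ ltr01.
apply/eqP; rewrite eq_le; apply/andP; split; last first.
  by apply: lb_le_inf => //; exists s0.
apply/ler_addgt0Pl => e /Sr[s Ss sr]; rewrite addrC; apply: le_trans sr.
by apply: ge_inf => //; exists r.
Qed.

Theorem corollary2p1 (R : realType) (H : hilbertType R)
    (H_neq0 : exists x : H, x != 0)
    (lam : R) (lam_ge0 : 0 <= lam) (lam_le1 : lam <= 1)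
    (T : bounded_op H) (n : nat) :
  spectral_radius T
    = inf [set opnorm (iter n (aluthge lam) (X * T * inv_op X))
          | X in [set X : bounded_op H | invertible X]]
  /\
  inf [set opnorm (iter n (aluthge lam) (X * T * inv_op X))
      | X in [set X : bounded_op H | invertible X]]
    = inf [set opnorm (iter n (aluthge lam) (exp_op A * T * exp_op (- A)))
          | A in [set A : bounded_op H | self_adjoint A]].
Proof.
have lb (X : bounded_op H) : invertible X -> spectral_radius T <=
    opnorm (iter n (aluthge lam) (X * T * inv_op X)).
  move=> iX; rewrite -(spectral_radius_similar T iX).
  rewrite -(spectral_radius_iter_aluthge H_neq0 lam_ge0 lam_le1 n).
  exact: spectral_radius_le_opnorm.
have ub (e : R) : 0 < e -> exists2 A : bounded_op H, self_adjoint A &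
    opnorm (iter n (aluthge lam) (exp_op A * T * exp_op (- A))) <=
    spectral_radius T + e.
  move=> e0; have [|A AA Ale] := exp_similarity_opnorm_le H_neq0 (T := T)
    (r := spectral_radius T + e); first by rewrite ltrDl.
  exists A => //; apply: le_trans Ale.
  exact: (opnorm_iter_aluthge_le H_neq0).
(* The exponentials are among the invertible operators, so the second set of norms lies inside the
   first: [lb] on the larger set and [ub] on the smaller one settle both infima. *)
have expV (A : bounded_op H) : self_adjoint A ->
    invertible (exp_op A) /\ inv_op (exp_op A) = exp_op (- A).
  move=> /(exp_op_inverse H_neq0) AV; split; first by exists (exp_op (- A)).
  exact: is_inverse_inv_op.
have -> : inf [set opnorm (iter n (aluthge lam) (X * T * inv_op X))
    | X in [set X : bounded_op H | invertible X]] = spectral_radius T.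
  apply: inf_eqP => [_ [X /= iX <-]|e /ub[A AA Ae]]; first exact: lb.
  have [iA AV] := expV _ AA; eexists; last exact: Ae.
  by exists (exp_op A) => //; rewrite AV.
split=> //; apply/esym/inf_eqP => [_ [A /= AA <-]|e /ub[A AA Ae]].
  by have [iA <-] := expV _ AA; exact: lb.
by eexists; last exact: Ae; exists A.
Qed.
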